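(* For all integers $b\geq2$ and $d,k\geq1$, and every $\delta>0$, there exists $N=N(b,d,k,\delta)$ such that, whenever $\mathbf n=(n_1,\ldots,n_d)\in\mathbb{Z}_{\geq0}^d$ satisfies $\min\{n_1,\ldots,n_d\}\geq N$, every $H\subset\Gamma_{\mathbf n}^{(b)}$ with $d(H)\geq\delta$ contains an arithmetic replica of $T_k^{(b^d)}$.
   Context: For an integer $b\geq 2$ let $\Lambda_b=\{0,1,\ldots,b-1\}$, and let $T_n^{(b)}=\Lambda_b^{\leq n}$ be the set of words of length at most $n$ over $\Lambda_b$, ordered by $u\preceq v$ iff $u$ is a prefix of $v$ (possibly $u=v$). The level $|u|$ is the word length; leaves of $T_n^{(b)}$ are the words of length $n$, and the children of a non-leaf $u$ are the words $u\lambda$, $\lambda\in\Lambda_b$. For $d\geq1$ and $\mathbf n\in\mathbb{Z}_{\geq0}^d$ let $\Gamma_{\mathbf n}^{(b)}=T_{n_1}^{(b)}\times\cdots\times T_{n_d}^{(b)}$, with $(u_1,\ldots,u_d)\preceq_d(v_1,\ldots,v_d)$ iff $u_i\preceq v_i$ for all $i$; $\mathbf v$ is a descendant of $\mathbf u$ if $\mathbf u\preceq_d\mathbf v$ (including $\mathbf v=\mathbf u$). The level of $\mathbf u$ is $|\mathbf u|=(|u_1|,\ldots,|u_d|)$. If $|u_i|<n_i$ for all $i$, the diagonal children of $\mathbf u$ are the $b^d$ vertices $(u_1\epsilon_1,\ldots,u_d\epsilon_d)$, $(\epsilon_1,\ldots,\epsilon_d)\in\Lambda_b^d$. The density of $H\subset\Gamma_{\mathbf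 n}^{(b)}$ is $$d(H)=\frac{1}{\prod_{j=1}^d(n_j+1)}\sum_{\mathbf 0\leq\mathbf i\leq\mathbf n}\frac{|\{x\in H:|x|=\mathbf i\}|}{b^{i_1+\cdots+i_d}},$$ where the sum is over $\mathbf i=(i_1,\ldots,i_d)\in\mathbb{Z}^d$ with $0\leq i_j\leq n_j$ for all $j$. A map $\phi:T_k^{(b^d)}\to\Gamma_{\mathbf n}^{(b)}$ is a regular embedding if (i) $|x|=|y|$ implies $|\phi(x)|=|\phi(y)|$, and (ii) for every non-leaf $x\in T_k^{(b^d)}$, $\phi$ maps each of the $b^d$ distinct children of $x$ to a descendant of a distinct diagonal child of $\phi(x)$. Its image is called a replica of $T_k^{(b^d)}$, and is contained in $H$ if the image lies in $H$. The signature of $\phi$ is the sequence of levels $\mathbf i_0<\cdots<\mathbf i_k$ (strictly increasing in each coordinate) such that $\phi$ maps level $t$ of $T_k^{(b^d)}$ into level $\mathbf i_t$. The replica is arithmetic if there is $\mathbf a\in\mathbb{Z}_{\geq1}^d$ with $\mathbf i_t=\mathbf i_0+t\mathbf a$ for $t=0,1,\ldots,k$. *)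

(* Defs.v *)
From HB Require Import structures.
From mathcomp Require Import all_boot all_order all_algebra.
From mathcomp Require Import reals.

Set Implicit Arguments.
Unset Strict Implicit.
Unset Printing Implicit Defensive.

Notation Tree b n := (n.-bseq 'I_b).

Definition tree_child (b n : nat) (x y : Tree b n) : bool :=
  [exists c : 'I_b, val y == rcons x c].

Notation Gamma b n := {dffun forall j, Tree b (n j)}.

Section Product.
Variables (b d : nat) (n : 'I_d -> nat).

Definition level (u : Gamma b n) : {ffun 'I_d -> nat} :=
  [ffun j => size (u j)].

Definition Gamma_le (u v : Gamma b n) : bool := [forall j, prefix (u j) (v j)].

(* [v] is a diagonal child of [u]. Since [v] is a vertex of [Gamma b n], this
   forces [size (u j) < n j] for all [j]. *)
Definition diag_child (u v : Gamma b n) : bool :=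
  [exists e : {ffun 'I_d -> 'I_b}, forall j, val (v j) == rcons (u j) (e j)].

Definition density (R : realType) (H : {set Gamma b n}) : R :=
  ((\prod_j (n j).+1)%N%:R^-1 *
   \sum_(i : {dffun forall j, 'I_(n j).+1})
     #|[set x in H | level x == [ffun j => nat_of_ord (i j)]]|%:R
       / b%:R ^+ (\sum_j i j)%N)%R.

Section Embedding.
Variables (k : nat) (phi : Tree (b ^ d) k -> Gamma b n).

(* [f] assigns to each child of [x] the diagonal child of [phi x] below which
   the image of that child lies. *)
Definition regular_embedding : Prop :=
  (forall x y : Tree (b ^ d) k,
     size x = size y -> level (phi x) = level (phi y)) /\
  (forall x : Tree (b ^ d) k, size x < k ->
     exists f : Tree (b ^ d) k -> Gamma b n,
       {in tree_child x &, injective f} /\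
       (forall y, tree_child x y ->
          diag_child (phi x) (f y) /\ Gamma_le (f y) (phi y))).

Definition is_signature (s : 'I_k.+1 -> {ffun 'I_d -> nat}) : Prop :=
  (forall t t' : 'I_k.+1, t < t' -> forall j, s t j < s t' j) /\
  (forall (x : Tree (b ^ d) k) (t : 'I_k.+1),
     size x = t -> level (phi x) = s t).

Definition arithmetic : Prop :=
  exists s : 'I_k.+1 -> {ffun 'I_d -> nat},
    is_signature s /\
    exists a : 'I_d -> nat,
      (forall j, 1 <= a j) /\
      (forall (t : 'I_k.+1) j, s t j = s ord0 j + t * a j).

End Embedding.

Definition arithmetic_replica (k : nat) (S : {set Gamma b n}) : Prop :=
  exists phi : Tree (b ^ d) k -> Gamma b n,
    [/\ regular_embedding phi, arithmetic phi &
        S = [set phi x | x : Tree (b ^ d) k]].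

End Product.

(* Main.v *)
Require Import Defs.
From mathcomp Require Import all_boot all_order all_algebra.
From mathcomp Require Import boolp reals.
From mathcomp Require Import ring lra zify.

Set Implicit Arguments.
Unset Strict Implicit.
Unset Printing Implicit Defensive.

(** Replicas whose levels form an arithmetic progression contain Szemeredi's
    theorem (take for [H] a union of levels), and conversely the statement is
    reduced to that theorem, which is itself deduced from the density
    Hales-Jewett theorem.

    Density Hales-Jewett.  The theorem over an alphabet [T] implies the theorem
    over [option T] ([DHJ_option]); the added letter [None] serves at the same
    time as the wildcard of the lines over [T].  Let [delta] be the infimum of
    the densities that force a line over [option T], and suppose that it is
    positive.  A line-free set [A] of density close to [delta] has density close
    to [delta] on each of the subcubes obtained by fixing a few letters.  By the theorem over
    [T], a positive proportion [theta] of words [x] over [option T], on suitable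
    subcubes, are lines over [T] contained in [A]: each word obtained by
    replacing [None] with a letter [t] of [T] is in [A].  The set [D t] of the
    [x] for which this holds for the letter [t] does not see the difference
    between [None] and [t]: it is insensitive.  As [A] has no line over
    [option T], it does not meet the intersection of the [D t], so it is denser
    than [delta] on the complement of that intersection ([correlation]).  This
    complement splits into intersections of insensitive sets, each of which is
    up to a small error a disjoint union of subspaces, again by the theorem
    over [T] ([insensitive_subspace], [insensitive_inter_avg_le]).  So [A] has
    density larger than [delta] on a subspace and contains a line after all
    ([density_decrement]).

    Trees.  A set [H] of vertices of a [beta]-ary tree realizes a set of levels
    when these are the levels of a replica contained in [H].  An induction on
    the depth bounds the weighted number of realized sets of levels from below
    by an exponential in the density of [H] ([branch_avg_ge], [branch_avg_le]).
    Small sets of levels are too few to account for it, so some realized set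
    contains a positive proportion of the levels, hence an arithmetic
    progression ([realized_progression]); the replica restricts to it.

    Products.  The vertices that are reached from a vertex [u] of the product by
    diagonal steps form a [b ^ d]-ary tree, and the regular embeddings of that
    tree are regular embeddings into the product.  Averaging over [u] gives
    such a tree of prescribed depth in which [H] is dense
    ([dense_diagonal_tree]). *)

Import Order.TTheory GRing.Theory Num.Theory.
Local Open Scope ring_scope.

(** * Averages over finite types *)

Definition avg (R : realType) (T : finType) (f : T -> R) : R :=
  (\sum_x f x) / #|T|%:R.

Section Averages.
Variable R : realType.
Implicit Types (T U : finType).

Lemma avg_le T (f g : T -> R) : (forall x, f x <= g x) -> avg f <= avg g.
Proof. by move=> le_fg; rewrite ler_wpM2r ?invr_ge0 ?ler0n ?ler_sum. Qed.

Lemma eq_avg T (f g : T -> R) : f =1 g -> avg f = avg g.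
Proof. by move=> eq_fg; congr (_ / _); apply: eq_bigr. Qed.

Lemma avgD T (f g : T -> R) : avg (fun x => f x + g x) = avg f + avg g.
Proof. by rewrite /avg big_split mulrDl. Qed.

Lemma avgZ T (c : R) (f : T -> R) : avg (fun x => c * f x) = c * avg f.
Proof. by rewrite /avg -mulr_sumr mulrA. Qed.

Lemma avgN T (f : T -> R) : avg (fun x => - f x) = - avg f.
Proof. by rewrite /avg sumrN mulNr. Qed.

Lemma avg_cst T (c : R) : (0 < #|T|)%N -> avg (fun _ : T => c) = c.
Proof.
by move=> T0; rewrite /avg sumr_const -[c *+ _]mulr_natr mulfK // pnatr_eq0 -lt0n.
Qed.

Lemma avg_sum T U (F : U -> T -> R) :
  avg (fun x => \sum_u F u x) = \sum_u avg (F u).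
Proof. by rewrite /avg exchange_big mulr_suml. Qed.

Lemma avg_exchange T U (F : T -> U -> R) :
  avg (fun x => avg (F x)) = avg (fun u => avg (F^~ u)).
Proof.
rewrite /avg -!mulr_suml exchange_big /= -!mulrA; congr (_ * _); exact: mulrC.
Qed.

Lemma avg_pair T U (F : T * U -> R) :
  avg F = avg (fun x => avg (fun u => F (x, u))).
Proof.
rewrite /avg card_prod natrM -mulr_suml pair_bigA /= invfM mulrA mulrAC.
by congr (_ / _ / _); apply: eq_bigr => -[].
Qed.

Lemma avg_bij T U (h : T -> U) (f : U -> R) :
  bijective h -> avg f = avg (fun x => f (h x)).
Proof.
move=> bij_h; rewrite /avg (bij_eq_card bij_h); congr (_ / _).
by rewrite (reindex h) //; exact: onW_bij.
Qed.

Lemma avg_ge0 T (f : T -> R) : (forall x, 0 <= f x) -> 0 <= avg f.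
Proof. by move=> f0; rewrite divr_ge0 ?sumr_ge0. Qed.

Lemma avg_le0 T (f : T -> R) : (forall x, f x <= 0) -> avg f <= 0.
Proof. by move=> f0; rewrite -oppr_ge0 -avgN avg_ge0 // => x; rewrite oppr_ge0. Qed.

Lemma avg_le1 T (f : T -> R) : (forall x, f x <= 1) -> avg f <= 1.
Proof.
move=> f1; have [T0|T0] := posnP #|T|; first by rewrite /avg T0 invr0 mulr0.
by rewrite -(avg_cst 1 T0) avg_le.
Qed.

Lemma avg_attained T (f : T -> R) (c : R) :
  (0 < #|T|)%N -> c <= avg f -> exists x, c <= f x.
Proof.
move=> T0 cf; apply/existsP; apply: contraLR cf; rewrite negb_exists.
move=> /forallP lt_fc; rewrite -ltNge ltr_pdivrMr ?ltr0n //.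
have -> : c * #|T|%:R = \sum_(x : T) c by rewrite sumr_const mulr_natr.
case/card_gt0P: T0 => x0 _; rewrite [ltLHS](bigD1 x0) ?[ltRHS](bigD1 x0) //=.
apply: ltr_leD; first by rewrite ltNge lt_fc.
by apply: ler_sum => x _; rewrite ltW // ltNge lt_fc.
Qed.

Lemma ge_avg_term T (f : T -> R) x : (forall x, 0 <= f x) ->
  f x / #|T|%:R <= avg f.
Proof.
move=> f0; rewrite ler_wpM2r ?invr_ge0 ?ler0n //.
by rewrite (bigD1 x) //= lerDl sumr_ge0.
Qed.

Lemma avg_prod T U (g : U -> T -> R) :
  avg (fun v : {ffun U -> T} => \prod_u g u (v u)) = \prod_u avg (g u).
Proof.
rewrite /avg -bigA_distr_bigA /= prodf_div; congr (_ / _).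
by rewrite prodr_const card_ffun natrX.
Qed.

(** Markov's inequality followed by the pigeonhole principle: [a] is at least
    [delta / 2] on a set of density [delta / 2], and if each such point has a
    witness then one witness serves a positive proportion of points. *)
Lemma popular_witness T U (P : U -> T -> bool) (a : T -> R) (delta : R) :
  0 < delta -> (forall x, a x <= 1) -> delta <= avg a ->
  (forall x, delta / 2 <= a x -> exists u, P u x) ->
  exists u, delta / 2 / #|U|%:R <= avg (fun x => (P u x)%:R : R).
Proof.
move=> d0 a1 da wit.
have T0 : (0 < #|T|)%N.
  by rewrite lt0n; apply: contraTneq da => T0; rewrite /avg T0 invr0 mulr0 -ltNge.
have half : delta / 2 <= \sum_u avg (fun x => (P u x)%:R : R).
  rewrite -avg_sum -(lerD2l (delta / 2)) -splitr -[X in X + _](avg_cst _ T0) -avgD.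
  apply: le_trans da (avg_le _) => x.
  case: (lerP (delta / 2) (a x)) => [/wit[u Pux]|lt_a]; last first.
    by rewrite (le_trans (ltW lt_a)) // lerDl sumr_ge0.
  apply: le_trans (a1 x) _; rewrite -[leLHS]add0r; apply: lerD; first lra.
  by rewrite (bigD1 u) //= Pux lerDl sumr_ge0.
have U0 : (0 < #|U|)%N.
  rewrite lt0n; apply: contraTneq half => U0; rewrite -ltNge big_pred0 ?divr_gt0 //.
  by move=> u; have := fintype0 u U0.
apply: avg_attained U0 _; rewrite /avg ler_wpM2r ?invr_ge0 ?ler0n //.
Qed.

End Averages.

Lemma pow_small (R : realType) (c eps : R) :
  0 < c -> c <= 1 -> 0 < eps -> exists s, (1 - c) ^+ s <= eps.
Proof.
move=> c0 c1 e0; pose s := Num.bound (eps^-1 / c); exists s.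
have s_big : eps^-1 / c < s%:R.
  by apply: archi_boundP; rewrite divr_ge0 ?invr_ge0 ?ltW.
have bern n : (1 - c) ^+ n * (1 + n%:R * c) <= 1.
  elim: n => [|n IHn]; first by rewrite expr0 mul0r addr0 mulr1.
  apply: le_trans IHn; rewrite exprSr -mulrA ler_wpM2l ?exprn_ge0 //; first lra.
  have n0 : 0 <= n%:R :> R by [].
  rewrite -natr1; nra.
rewrite ltr_pdivrMr // in s_big.
have sc0 : 0 < s%:R * c by apply: lt_trans s_big; rewrite invr_gt0.
apply: le_trans (_ : (1 + s%:R * c)^-1 <= _).
  rewrite -[leRHS]mul1r ler_pdivlMr ?bern //; lra.
rewrite -[leRHS]invrK lef_pV2 ?posrE ?invr_gt0 //; lra.
Qed.

(** * Words, combinatorial lines and subspaces *)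

Notation word I T := {ffun I -> T}.

(** A line is a word with [None] for the wildcard, so that words over the
    alphabet [option T] are also the lines over the alphabet [T]. *)
Definition line_pt (I T : finType) (l : word I (option T)) (t : T) : word I T :=
  [ffun i => odflt t (l i)].

Definition has_line (I T : finType) (A : word I T -> bool) : Prop :=
  exists l : word I (option T),
    (exists i, l i = None) /\ forall t, A (line_pt l t).

Definition template (I T M : finType) := word I (T + M)%type.

Definition sub_pt (I T M : finType) (phi : template I T M) (y : word M T) :
    word I T :=
  [ffun i => match phi i with inl t => t | inr m => y m end].

Definition onto (I T M : finType) (phi : template I T M) : bool :=
  [forall m, exists i, phi i == inr m].

Definition glue (I J T : finType) (y : word I T) (z : word J T) :
    word (I + J)%type T :=
  [ffun i => match i with inl a => y a | inr b => z b end].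

Lemma ontoP (I T M : finType) (phi : template I T M) :
  reflect (forall m, exists i, phi i = inr m) (onto phi).
Proof.
apply: (iffP forallP) => phiM m; first by have /existsP[i /eqP] := phiM m; exists i.
by have [i <-] := phiM m; apply/existsP; exists i.
Qed.

Lemma sub_pt_inj (I T M : finType) (phi : template I T M) :
  onto phi -> injective (sub_pt phi).
Proof.
move=> /ontoP phiM y y' eq_yy'; apply/ffunP => m; have [i phi_i] := phiM m.
by have /ffunP/(_ i) := eq_yy'; rewrite !ffunE phi_i.
Qed.

Lemma word_card_gt0 (I T : finType) : (0 < #|T|)%N -> (0 < #|word I T|)%N.
Proof. by move=> T0; rewrite card_ffun expn_gt0 T0. Qed.

Lemma glue_bij (I J T : finType) :
  bijective (fun p : word I T * word J T => glue p.1 p.2).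
Proof.
exists (fun x : word (I + J)%type T =>
          ([ffun a => x (inl a)], [ffun b => x (inr b)])) => [[y z]|x].
  by congr (_, _); apply/ffunP => i; rewrite !ffunE.
by apply/ffunP => -[a|b]; rewrite !ffunE.
Qed.

Lemma avg_glue (R : realType) (I J T : finType) (f : word (I + J)%type T -> R) :
  avg f = avg (fun y => avg (fun z => f (glue y z))).
Proof. by rewrite (avg_bij f (glue_bij I J T)) avg_pair. Qed.

(** Index sets are arbitrary finite types, so that a product of two sets of
    words is again one, indexed by a sum type.  In [DHJ] a single index set is
    enough: fixing some letters carries the statement over to larger ones. *)
Definition DHJ_on (R : realType) (T : finType) (delta : R) (I : finType) :=
  forall A : word I T -> bool,
    delta <= avg (fun x => (A x)%:R : R) -> has_line A.

Definition DHJ (R : realType) (T : finType) :=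
  forall delta : R, 0 < delta -> exists I : finType, DHJ_on T delta I.

Definition mDHJ_on (R : realType) (T M : finType) (delta : R) (I : finType) :=
  forall A : word I T -> bool,
    delta <= avg (fun x => (A x)%:R : R) ->
    exists phi : template I T M, onto phi /\ forall y, A (sub_pt phi y).

Section Multidim.
Variables (R : realType) (T : finType).
Hypothesis T_gt0 : (0 < #|T|)%N.
Hypothesis dhjT : DHJ R T.

Lemma indic_le1 (b : bool) : b%:R <= 1 :> R.
Proof. by case: b. Qed.

(** For many words [z] over the second set of indices, the section at [z]
    contains a line, for many of them the same line; the set of these [z] is
    dense and contains a subspace of dimension one less. *)
Lemma mDHJ_option (M : finType) :
  (forall delta : R, 0 < delta -> exists I, mDHJ_on T M delta I) ->
  forall delta : R, 0 < delta -> exists I, mDHJ_on T (option M) delta I.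
Proof.
move=> IH delta d0.
have [I1 dhj1] : exists I, DHJ_on T (delta / 2) I by apply: dhjT; lra.
pose L := word I1 (option T).
have L0 : (0 < #|L|)%N by apply: word_card_gt0; rewrite card_option.
have c0 : 0 < delta / 2 / #|L|%:R by rewrite !divr_gt0 ?ltr0n.
have [I2 dhj2] := IH _ c0.
exists (I1 + I2)%type => A.
rewrite avg_glue avg_exchange => dA.
pose P (l : L) (z : word I2 T) :=
  [exists i, l i == None] && [forall t, A (glue (line_pt l t) z)].
have [|z|l /dhj2[phi [phiM phiA]]] :=
  @popular_witness R _ _ P _ _ d0 _ dA.
- by move=> z; apply: avg_le1 => y; apply: indic_le1.
- move=> /dhj1[l [[i li] lA]]; exists l; apply/andP; split.
    by apply/existsP; exists i; rewrite li.
  exact/forallP.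
have [x0 _] : exists x : word M T, true.
  by have /card_gt0P[x _] := word_card_gt0 M T_gt0; exists x.
have /andP[/existsP[i0 /eqP li0] _] := phiA x0.
exists [ffun i => match i with
  | inl a => if l a is Some t then inl t else inr None
  | inr b => match phi b with inl t => inl t | inr m => inr (Some m) end
  end]; split.
  apply/ontoP => -[m|]; last by exists (inl i0); rewrite ffunE li0.
  by have /ontoP/(_ m)[i phi_i] := phiM; exists (inr i); rewrite ffunE phi_i.
move=> y; have /andP[_ /forallP/(_ (y None))] := phiA [ffun m => y (Some m)].
congr A; apply/ffunP => -[a|b]; rewrite !ffunE.
  by case: (l a).
by case: (phi b) => // m; rewrite ffunE.
Qed.

Lemma mDHJ_surj (M N : finType) (g : M -> N) delta I :
  (forall n, exists m, g m = n) -> @mDHJ_on R T M delta I ->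
  @mDHJ_on R T N delta I.
Proof.
move=> g_surj dhjM A /dhjM[phi [/ontoP phiM phiA]].
exists [ffun i => match phi i with inl t => inl t | inr m => inr (g m) end]; split.
  apply/ontoP => n; have [m <-] := g_surj n; have [i phi_i] := phiM m.
  by exists i; rewrite ffunE phi_i.
move=> y; have := phiA [ffun m => y (g m)].
by congr A; apply/ffunP => i; rewrite !ffunE; case: (phi i) => // m; rewrite ffunE.
Qed.

(** Iterating the density theorem for lines gives subspaces of any dimension. *)
Lemma mDHJ (M : finType) (delta : R) :
  0 < delta -> exists I, mDHJ_on T M delta I.
Proof.
move=> d0.
suff [I dhjI] : exists I, mDHJ_on T 'I_#|M| delta I.
  exists I; apply: (mDHJ_surj (g := fun i : 'I_#|M| => enum_val i)) dhjI => m.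
  by exists (enum_rank m); rewrite enum_rankK.
elim: #|M| delta d0 => [|m IHm] delta d0.
  exists 'I_0 => A dA; have [|x Ax] := avg_attained _ dA.
    exact: word_card_gt0.
  have {}Ax : A x by case: (A x) Ax => //; rewrite mulr0n leNgt d0.
  exists [ffun i => inl (x i)]; split; first by apply/ontoP => -[].
  by move=> y; congr (A _) : Ax; apply/ffunP => i; rewrite !ffunE.
have [I dhjI] := mDHJ_option IHm d0; exists I.
pose g (o : option 'I_m) : 'I_m.+1 := if o is Some i then lift ord0 i else ord0.
apply: (mDHJ_surj (g := g)) dhjI => n.
by case: (unliftP ord0 n) => [j ->|->]; [exists (Some j) | exists None].
Qed.

End Multidim.

(** * Insensitive sets *)

Section Insensitive.
Variables (R : realType) (T : finType).
Local Notation S := (option T).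

Definition collapse (I : finType) (t : T) (x : word I S) : word I S :=
  [ffun i => Some (odflt t (x i))].

Definition insensitive (I : finType) (t : T) (P : word I S -> bool) : Prop :=
  forall x, P (collapse t x) = P x.

Lemma collapse_glue (I J : finType) t (y : word I S) (z : word J S) :
  collapse t (glue y z) = glue (collapse t y) (collapse t z).
Proof. by apply/ffunP => -[i|i]; rewrite !ffunE. Qed.

Lemma collapse_idem (I : finType) t (x : word I S) :
  collapse t (collapse t x) = collapse t x.
Proof. by apply/ffunP => i; rewrite !ffunE. Qed.

Lemma insensitive_section (I J : finType) t (P : word (I + J)%type S -> bool) y :
  insensitive t P -> insensitive t (fun z => P (glue y z)).
Proof.
move=> insP z.
by rewrite -insP collapse_glue collapse_idem -collapse_glue insP.
Qed.

Lemma collapse_sub_pt (I M : finType) t (phi : template I S M) y :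
  collapse t (sub_pt phi (collapse t y)) = collapse t (sub_pt phi y).
Proof. by apply/ffunP => i; rewrite !ffunE; case: (phi i) => // m; rewrite ffunE. Qed.

Lemma insensitive_sub_pt (I M : finType) t (phi : template I S M) P :
  insensitive t P -> insensitive t (fun y => P (sub_pt phi y)).
Proof. by move=> insP y; rewrite -insP collapse_sub_pt insP. Qed.

Section Resample.
Variables (I C : finType).
Implicit Types (v : word (I * C)%type S) (w : word I T).

Definition pick_letter v (i : I) : option C := [pick c | v (i, c) != None].

Definition resample v w : word (I * C)%type S :=
  [ffun p => if pick_letter v p.1 == Some p.2 then Some (w p.1) else v p].

Definition picked v w : word I T :=
  [ffun i => if pick_letter v i is Some c then odflt (w i) (v (i, c)) else w i].

Lemma pick_letterP v i c : pick_letter v i = Some c -> v (i, c) != None.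
Proof. by rewrite /pick_letter; case: pickP => // c' vc' [<-]. Qed.

Lemma pick_letter_resample v w : pick_letter (resample v w) =1 pick_letter v.
Proof.
move=> i; apply: eq_pick => c /=; rewrite ffunE /=.
by case: (pick_letter v i =P Some c) => // /pick_letterP ->.
Qed.

(** Exchanging the picked letters with the new ones is an involution, because
    it does not change which letters are picked. *)
Lemma resample_bij : bijective (fun p => (resample p.1 p.2, picked p.1 p.2)).
Proof.
apply: inv_bij => -[v w] /=; congr (_, _); apply/ffunP.
  move=> -[i c]; rewrite !ffunE /= pick_letter_resample.
  case: (pick_letter v i =P Some c) => // vi; rewrite vi.
  by case: (v _) (pick_letterP vi).
move=> i; rewrite !ffunE pick_letter_resample.
case vi: (pick_letter v i) => [c|//]; rewrite ffunE /= vi eqxx //.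
Qed.

End Resample.

Lemma avg_allNone (I C : finType) (i : I) :
  avg (fun v : word (I * C)%type S => [forall c, v (i, c) == None]%:R : R)
    = #|{: S}|%:R ^- #|C|.
Proof.
pose g (p : I * C) (s : S) : R := if p.1 == i then (s == None)%:R else 1.
have S0 : (0 < #|{: S}|)%N by rewrite card_option.
have blocks (F : I * C -> R) : \prod_p F p = \prod_j \prod_c F (j, c).
  by rewrite pair_bigA; apply: eq_bigr => -[].
transitivity (avg (fun v : word (I * C)%type S => \prod_p g p (v p))).
  apply: eq_avg => v; rewrite blocks.
  rewrite (bigD1 i) //= [X in _ * X]big1 ?mulr1 => [|j /negPf nji]; last first.
    by rewrite big1 // => c _; rewrite /g /= nji.
  rewrite /g /= eqxx; case: forallP => [vN|vN].
    by rewrite big1 // => c _; rewrite vN.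
  have [c vc] : exists c, v (i, c) != None.
    by apply/existsP; rewrite -negb_forall; apply/forallP.
  by rewrite (bigD1 c) //= (negPf vc) mul0r.
rewrite avg_prod blocks.
rewrite (bigD1 i) //= [X in _ * X]big1 ?mulr1 => [|j /negPf nji]; last first.
  by rewrite big1 // => c _; rewrite /g /= nji avg_cst.
rewrite -exprVn -prodr_const; apply: eq_bigr => c _; rewrite /g /= eqxx /avg.
by rewrite (bigD1 None) //= big1 ?addr0 ?mul1r // => s /negPf ->.
Qed.

Hypothesis T_gt0 : (0 < #|T|)%N.
Hypothesis dhjT : DHJ R T.

(** A dense insensitive set contains subspaces.  Uniform words over [option T]
    collapse to words over [T] with a non-uniform distribution; resampling one
    letter of [T] in each of many blocks recovers the uniform distribution on a
    subcube, to which the density theorem over [T] applies. *)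
Lemma insensitive_subspace (t : T) (M : finType) (delta : R) : 0 < delta ->
  exists I : finType, forall P : word I S -> bool, insensitive t P ->
    delta <= avg (fun x => (P x)%:R : R) ->
    exists phi : template I S M, onto phi /\ forall y, P (sub_pt phi y).
Proof.
move=> d0; have d20 : 0 < delta / 2 by lra.
have [I dhjI] := mDHJ T_gt0 dhjT M d20.
have S0 : (0 < #|{: S}|)%N by rewrite card_option.
have S2 : 2 <= #|{: S}|%:R :> R by rewrite ler_nat card_option.
have [n small_n] : exists n, #|I|%:R * #|{: S}|%:R ^- n <= delta / 2.
  have [|||n hn] := @pow_small R (1 - #|{: S}|%:R^-1) (delta / 2 / (#|I|.+1)%:R).
  - by rewrite subr_gt0 invf_lt1; lra.
  - by rewrite gerBl invr_ge0.
  - by rewrite divr_gt0 // ltr0n.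
  exists n; rewrite subKr ler_pdivlMr ?ltr0n // exprVn in hn.
  apply: le_trans hn; rewrite mulrC ler_wpM2l ?invr_ge0 ?exprn_ge0 //.
  by rewrite ler_nat.
exists (I * 'I_n)%type => P insP dP.
pose bad (v : word (I * 'I_n)%type S) := [exists i, forall c, v (i, c) == None].
have small_bad : avg (fun v => (bad v)%:R : R) <= delta / 2.
  apply: le_trans small_n.
  apply: (@le_trans _ _ (avg (fun v : word (I * 'I_n)%type S =>
            \sum_i [forall c, v (i, c) == None]%:R : R))).
    apply: avg_le => v; rewrite /bad; case: existsP => [[i vi]|_]; last first.
      by rewrite sumr_ge0.
    by rewrite (bigD1 i) //= vi lerDl sumr_ge0.
  rewrite avg_sum (eq_bigr _ (fun i _ => avg_allNone _ i)) card_ord.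
  by rewrite sumr_const mulr_natl.
have [v dv] : exists v, delta / 2 <=
    avg (fun w : word I T => (P (resample v w))%:R) + - (bad v)%:R.
  apply: avg_attained; first exact: word_card_gt0.
  rewrite avgD avgN -(avg_pair (fun p => (P (resample p.1 p.2))%:R)).
  suff -> : avg (fun p => (P (@resample I 'I_n p.1 p.2))%:R : R) =
      avg (fun v => (P v)%:R) by lra.
  have := avg_bij (fun p => (P p.1)%:R : R) (@resample_bij I 'I_n).
  move=> /= <-; rewrite avg_pair; apply: eq_avg => v /=.
  by rewrite avg_cst //; exact: word_card_gt0.
have good_v : ~~ bad v.
  apply: contraTN dv => ->; rewrite -ltNge; apply: le_lt_trans d20.
  by rewrite subr_le0 avg_le1 // => w; exact: indic_le1.
rewrite (negPf good_v) oppr0 addr0 in dv.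
have [psi [/ontoP psiM psiP]] := dhjI _ dv.
have letter_v i : exists2 c, pick_letter v i = Some c & v (i, c) != None.
  rewrite /pick_letter; case: pickP => [c vc|vN]; first by exists c.
  case/negP: good_v; apply/existsP; exists i; apply/forallP => c.
  exact/negPn/negbT/vN.
exists [ffun p => if pick_letter v p.1 == Some p.2 then
    match psi p.1 with inl s => inl (Some s) | inr m => inr m end
  else inl (v p)]; split.
  apply/ontoP => m; have [i psi_i] := psiM m; have [c vi _] := letter_v i.
  by exists (i, c); rewrite ffunE /= vi eqxx psi_i.
move=> y; rewrite -insP; have := psiP [ffun m => odflt t (y m)].
rewrite -insP; congr P; apply/ffunP => -[i c]; rewrite !ffunE /=.
by case: ifP => // _; case: (psi i) => // m; rewrite !ffunE.
Qed.

End Insensitive.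

(** * Averages over insensitive sets *)

Definition nonpos_on_subspaces (R : realType) (I S M : finType)
    (f : word I S -> R) : Prop :=
  forall phi : template I S M, onto phi -> avg (fun y => f (sub_pt phi y)) <= 0.

Section Subspaces.
Variables (R : realType) (S : finType).

Lemma nonpos_section_l (I J M : finType) (f : word (I + J)%type S -> R) y :
  nonpos_on_subspaces M f -> nonpos_on_subspaces M (fun z => f (glue y z)).
Proof.
move=> f0 phi /ontoP phiM.
pose psi : template (I + J)%type S M :=
  [ffun i => match i with inl a => inl (y a) | inr b => phi b end].
have /f0 : onto psi.
  by apply/ontoP => m; have [b phi_b] := phiM m; exists (inr b); rewrite ffunE.
congr (_ <= _); apply: eq_avg => u; congr f.
by apply/ffunP => -[a|b]; rewrite !ffunE.
Qed.

Lemma nonpos_section_r (I J M : finType) (f : word (I + J)%type S -> R) z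
    (phi : template I S M) :
  nonpos_on_subspaces M f -> onto phi ->
  avg (fun u => f (glue (sub_pt phi u) z)) <= 0.
Proof.
move=> f0 /ontoP phiM.
pose psi : template (I + J)%type S M :=
  [ffun i => match i with inl a => phi a | inr b => inl (z b) end].
have /f0 : onto psi.
  by apply/ontoP => m; have [b phi_b] := phiM m; exists (inl b); rewrite ffunE.
congr (_ <= _); apply: eq_avg => u; congr f.
by apply/ffunP => -[a|b]; rewrite !ffunE.
Qed.

Lemma nonpos_sub_pt (I J M : finType) (f : word I S -> R) (phi : template I S J) :
  onto phi -> nonpos_on_subspaces M f ->
  nonpos_on_subspaces M (fun y => f (sub_pt phi y)).
Proof.
move=> /ontoP phiJ f0 psi /ontoP psiM.
pose chi : template I S M :=
  [ffun i => match phi i with inl s => inl s | inr j => psi j end].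
have /f0 : onto chi.
  apply/ontoP => m; have [j psi_j] := psiM m; have [i phi_i] := phiJ j.
  by exists i; rewrite ffunE phi_i.
congr (_ <= _); apply: eq_avg => u; congr f.
by apply/ffunP => i; rewrite !ffunE; case: (phi i) => // j; rewrite ffunE.
Qed.

End Subspaces.

Section Cover.
Variables (R : realType) (T : finType).
Local Notation S := (option T).
Hypothesis T_gt0 : (0 < #|T|)%N.
Hypothesis dhjT : DHJ R T.

(** [P] is exhausted by removing, again and again, a product [V * Z] of a
    subspace [V] and the insensitive set [Z] of those [z] for which the section
    of [P] at [z] contains [V]: each step removes a fixed proportion of [P],
    and [f] has a nonpositive average on each removed subspace. *)
Lemma insensitive_avg_le (t : T) (M : finType) (eps : R) :
  0 < eps -> eps <= 1 ->
  exists I : finType, forall (P : word I S -> bool) (f : word I S -> R),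
    insensitive t P -> (forall x, f x <= 1) -> nonpos_on_subspaces M f ->
    avg (fun x => (P x)%:R * f x) <= eps.
Proof.
move=> e0 e1; have S0 : (0 < #|{: S}|)%N by rewrite card_option.
have e2 : 0 < eps / 2 by lra.
have e4 : 0 < eps / 2 / 2 by lra.
have [J subJ] := insensitive_subspace T_gt0 dhjT t M e4.
pose Phi := template J S M.
have J0 : (0 < #|word J S|)%N by exact: word_card_gt0.
have Phi0 : (0 < #|Phi|)%N by apply: word_card_gt0; rewrite card_sum addn_gt0 S0.
(* A step removes at least this proportion of the words: [Z] has at least the
   density found by [popular_witness] and [V] at least one word. *)
pose c := eps / 2 / 2 / #|Phi|%:R / #|word J S|%:R.
have c0 : 0 < c by rewrite !divr_gt0 ?ltr0n.
have c1 : c <= 1.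
  rewrite !ler_pdivrMr ?ltr0n // mul1r.
  have : 1 <= #|word J S|%:R :> R by rewrite ler1n.
  have : 1 <= #|Phi|%:R :> R by rewrite ler1n.
  nra.
suff claim n : exists I : finType, forall P f,
    insensitive t P -> (forall x, f x <= 1) -> nonpos_on_subspaces M f ->
    avg (fun x : word I S => (P x)%:R * f x) <=
      eps / 2 + (1 - c) ^+ n * avg (fun x => (P x)%:R).
  have [n hn] := pow_small c0 c1 e2; have [I claimI] := claim n.
  exists I => P f insP f1 f0; apply: le_trans (claimI P f insP f1 f0) _.
  have a1 : avg (fun x => (P x)%:R : R) <= 1.
    by apply: avg_le1 => x; exact: indic_le1.
  have a0 : 0 <= avg (fun x => (P x)%:R : R) by exact: avg_ge0.
  have p0 : 0 <= (1 - c) ^+ n by rewrite exprn_ge0 // subr_ge0.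
  nra.
elim: n => [|n [I IH]].
  exists void => P f _ f1 _; rewrite expr0 mul1r.
  apply: (@le_trans _ _ (avg (fun x => (P x)%:R))); last by rewrite lerDr ltW.
  by apply: avg_le => x; case: (P x); rewrite ?mul1r ?mul0r ?f1.
exists (J + I)%type => P f insP f1 f0.
have p0 : 0 <= (1 - c) ^+ n by rewrite exprn_ge0 // subr_ge0.
have [sparse|dense] := lerP (avg (fun x => (P x)%:R : R)) (eps / 2).
  apply: (@le_trans _ _ (avg (fun x => (P x)%:R : R))).
    by apply: avg_le => x; case: (P x); rewrite ?mul1r ?mul0r ?f1.
  apply: le_trans sparse _; rewrite lerDl mulr_ge0 ?avg_ge0 //.
  by rewrite exprn_ge0 // subr_ge0.
pose inV (phi : Phi) (z : word I S) :=
  onto phi && [forall u, P (glue (sub_pt phi u) z)].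
have [||z|phi phiZ] := @popular_witness R _ _ inV
  (fun z => avg (fun y => (P (glue y z))%:R)) (eps / 2) e2.
- by move=> z; apply: avg_le1 => y; exact: indic_le1.
- by apply: le_trans (ltW dense) _; rewrite avg_glue avg_exchange.
- case/(subJ (fun y => P (glue y z))) => [y|phi [phiM phiP]].
    by rewrite -insP collapse_glue collapse_idem -collapse_glue insP.
  by exists phi; rewrite /inV phiM; apply/forallP.
have phiM : onto phi.
  have Z0 : (0 < #|word I S|)%N by exact: word_card_gt0.
  have pos : 0 < eps / 2 / 2 / #|Phi|%:R by rewrite divr_gt0 ?ltr0n.
  have := lt_le_trans pos phiZ; rewrite /inV; case: (onto phi) => //=.
  by rewrite avg_cst ?ltxx.
pose Z z := [forall u, P (glue (sub_pt phi u) z)].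
have {}phiZ : eps / 2 / 2 / #|Phi|%:R <= avg (fun z => (Z z)%:R : R).
  by apply: le_trans phiZ _; apply: avg_le => z; rewrite /inV phiM.
have insZ : insensitive t Z.
  move=> z; apply: eq_forallb => u.
  exact: (insensitive_section (sub_pt phi u) insP).
pose V y := [exists u, sub_pt phi u == y].
pose P' y z := P (glue y z) && ~~ (V y && Z z).
have splitP y z : (P (glue y z))%:R = (P' y z)%:R + (V y)%:R * (Z z)%:R :> R.
  rewrite /P'; case Vy: (V y); last by rewrite andbT mul0r addr0.
  case Zz: (Z z); last by rewrite andbT mulr0 addr0.
  rewrite andbF; case/existsP: Vy => u /eqP <-.
  by move/forallP: Zz => ->; rewrite add0r mulr1.
have on_V g : avg (fun y => (V y)%:R * g y) * #|word J S|%:R =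
    \sum_u g (sub_pt phi u) :> R.
  rewrite /avg divfK ?pnatr_eq0 -?lt0n //.
  rewrite (eq_bigr (fun y => if V y then g y else 0)) => [|y _]; last first.
    by case: (V y); rewrite ?mul1r ?mul0r.
  rewrite -big_mkcond /= (reindex_onto (sub_pt phi) (fun y =>
    odflt [ffun => None] [pick u | sub_pt phi u == y])) /=; last first.
    move=> y /existsP[u uy]; case: pickP => [v /eqP //|/(_ u)].
    by rewrite uy.
  apply: eq_bigl => u; apply/andP; split; first by apply/existsP; exists u.
  case: pickP => [v /eqP/(sub_pt_inj phiM) -> //|/(_ u)].
  by rewrite eqxx.
have V_big : #|word J S|%:R^-1 <= avg (fun y => (V y)%:R : R).
  have [u0 _] : exists u : word M S, true.
    by have /card_gt0P[u _] := word_card_gt0 M S0; exists u.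
  have := @ge_avg_term R _ (fun y => (V y)%:R) (sub_pt phi u0) (fun=> ler0n _ _).
  by rewrite (_ : V _) ?mul1r //; apply/existsP; exists u0.
have dP' : avg (fun y => avg (fun z => (P' y z)%:R : R)) <=
    (1 - c) * avg (fun x => (P x)%:R).
  have -> : avg (fun y => avg (fun z => (P' y z)%:R : R)) =
      avg (fun x => (P x)%:R) -
      avg (fun y => (V y)%:R) * avg (fun z => (Z z)%:R).
    rewrite avg_glue mulrC -avgZ -avgN -avgD; apply: eq_avg => y.
    rewrite mulrC -avgZ -avgN -avgD; apply: eq_avg => z.
    by rewrite splitP addrK.
  have a1 : avg (fun x => (P x)%:R : R) <= 1.
    by apply: avg_le1 => x; exact: indic_le1.
  rewrite mulrBl mul1r lerD2l lerN2; apply: (@le_trans _ _ c).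
    by rewrite ler_piMr // ltW.
  rewrite /c mulrC ler_pM ?invr_ge0 //; first by rewrite !divr_ge0 // ltW.
have ->  : avg (fun x => (P x)%:R * f x) =
    avg (fun y => avg (fun z => (P' y z)%:R * f (glue y z))) +
    avg (fun z => (Z z)%:R * avg (fun y => (V y)%:R * f (glue y z))).
  rewrite avg_glue.
  under [X in _ = _ + X]eq_avg => z do rewrite -avgZ.
  rewrite [X in _ = _ + X]avg_exchange -avgD; apply: eq_avg => y.
  rewrite -avgD; apply: eq_avg => z; rewrite splitP mulrDl; congr (_ + _).
  by rewrite mulrA [_%:R * _%:R]mulrC.
apply: le_trans (_ : avg (fun y => avg (fun z => (P' y z)%:R * f (glue y z))) <= _).
  rewrite gerDl; apply: avg_le0 => z; rewrite mulr_ge0_le0 //.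
  have Y0 : 0 < #|word J S|%:R :> R by rewrite ltr0n.
  rewrite -(pmulr_lle0 _ Y0) on_V.
  have := nonpos_section_r z f0 phiM.
  by rewrite /avg pmulr_lle0 // invr_gt0 ltr0n; apply: word_card_gt0.
have sections y : avg (fun z => (P' y z)%:R * f (glue y z)) <=
    eps / 2 + (1 - c) ^+ n * avg (fun z => (P' y z)%:R).
  apply: IH => [z|z|]; [|exact: f1|exact: nonpos_section_l].
  by rewrite /P' insZ (insensitive_section y insP z).
apply: le_trans (avg_le sections) _.
rewrite avgD avg_cst // avgZ exprSr -mulrA lerD2l.
by rewrite ler_wpM2l.
Qed.

(** The same for an intersection of insensitive sets, one letter at a time. *)
Lemma insensitive_inter_avg_le (s : seq T) (M : finType) (eps : R) :
  0 < eps -> eps <= 1 ->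
  exists I : finType, forall (E : T -> word I S -> bool) (f : word I S -> R),
    (forall t, insensitive t (E t)) -> (forall x, f x <= 1) ->
    nonpos_on_subspaces M f ->
    avg (fun x => (all (E^~ x) s)%:R * f x) <= eps.
Proof.
elim: s M eps => [|t s IH] M eps e0 e1.
  exists M => E f _ _ f0.
  pose phi : template M S M := [ffun m => inr m].
  have /f0 : onto phi by apply/ontoP => m; exists m; rewrite ffunE.
  move=> le0; apply: le_trans (le_trans le0 (ltW e0)).
  rewrite le_eqVlt; apply/orP; left; apply/eqP; apply: eq_avg => x /=; rewrite mul1r; congr f.
  by apply/ffunP => m; rewrite !ffunE.
have e20 : 0 < eps / 2 by lra.
have e21 : eps / 2 <= 1 by lra.
have [J HJ] := IH M _ e20 e21.
have [I HI] := insensitive_avg_le t J e20 e21.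
exists I => E f insE f1 f0 /=.
pose g x := (all (E^~ x) s)%:R * f x - eps / 2.
have : avg (fun x => (E t x)%:R * g x) <= eps / 2.
  apply: HI => // [x|phi phiJ].
    rewrite /g; have := f1 x; case: (all _ _); rewrite ?mul1r ?mul0r; lra.
  have := HJ (fun t y => E t (sub_pt phi y)) (fun y => f (sub_pt phi y)).
  move=> /(_ (fun t => insensitive_sub_pt phi (insE t)))/(_ (fun y => f1 _)).
  move=> /(_ (nonpos_sub_pt phiJ f0)) le_e2.
  rewrite /g avgD avg_cst ?subr_le0 //.
  by apply: word_card_gt0; rewrite card_option.
have -> : avg (fun x => (E t x)%:R * g x) =
    avg (fun x => ([&& E t x & all (E^~ x) s])%:R * f x) -
    eps / 2 * avg (fun x => (E t x)%:R).
  rewrite -avgZ -avgN -avgD; apply: eq_avg => x; rewrite /g.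
  by case: (E t x); rewrite /= ?mul0r ?mul1r ?mulr1 ?mulr0 ?subr0.
have : avg (fun x => (E t x)%:R : R) <= 1.
  by apply: avg_le1 => x; exact: indic_le1.
nra.
Qed.
End Cover.

(** * The density Hales-Jewett theorem *)

Lemma has_line_sub_pt (I S M : finType) (A : word I S -> bool)
    (phi : template I S M) :
  onto phi -> has_line (fun y => A (sub_pt phi y)) -> has_line A.
Proof.
move=> /ontoP phiM [l [[m lm] lA]].
exists [ffun i => match phi i with inl s => Some s | inr m => l m end]; split.
  by have [i phi_i] := phiM m; exists i; rewrite ffunE phi_i.
move=> s; have := lA s; congr A; apply/ffunP => i; rewrite !ffunE.
by case: (phi i) => // m'; rewrite ffunE.
Qed.

Lemma has_line_section (I J S : finType) (A : word (I + J)%type S -> bool) y :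
  has_line (fun z => A (glue y z)) -> has_line A.
Proof.
move=> [l [[j lj] lA]].
exists [ffun i => match i with inl a => Some (y a) | inr b => l b end]; split.
  by exists (inr j); rewrite ffunE.
by move=> s; have := lA s; congr A; apply/ffunP => -[a|b]; rewrite !ffunE.
Qed.

Lemma DHJ_on_le (R : realType) (T I : finType) (d d' : R) :
  d <= d' -> DHJ_on T d I -> DHJ_on T d' I.
Proof. by move=> dd' dhj A d'A; apply: dhj; exact: le_trans d'A. Qed.

Lemma line_free_avg_le (R : realType) (T I : finType) (d : R) A :
  DHJ_on T d I -> ~ has_line A -> avg (fun x : word I T => (A x)%:R) <= d.
Proof. by move=> dhj nA; rewrite leNgt; apply/negP => /ltW/dhj. Qed.

(** A function whose average is almost its upper bound is nowhere much smaller
    than that bound. *)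
Lemma ge_of_avg_ge (R : realType) (T : finType) (f : T -> R) (c e : R) :
  (forall x, f x <= c + e) -> c - e <= avg f ->
  forall x, c - 2 * e * #|T|%:R <= f x.
Proof.
move=> fc cf x; have T0 : (0 < #|T|)%N by apply/card_gt0P; exists x.
have := @ge_avg_term R T (fun x => c + e - f x) x.
rewrite avgD avgN avg_cst // ler_pdivrMr ?ltr0n // => le_x.
have {}le_x := le_x (fun x => _).
have {}le_x : c + e - f x <= (c + e - avg f) * #|T|%:R.
  by apply: le_x => y; rewrite subr_ge0.
have : (c + e - avg f) * #|T|%:R <= 2 * e * #|T|%:R.
  by rewrite ler_wpM2r //; lra.
have := fc x; have := avg_le fc; rewrite avg_cst //; lra.
Qed.

Section Step.
Variables (R : realType) (T : finType).
Local Notation S := (option T).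

Section Blocks.
Variables (M B : finType) (l : word M S) (r0 : M).
Implicit Types (v : word (M * B)%type S) (w : word B S).

(** Replacing a letter [None] of [v] in the block of [r] by the wildcard [r]
    gives a subspace of dimension [M] over the alphabet [T]; the extra index
    [(r, None)] ensures that each wildcard occurs. *)
Definition block_template v : template (M * option B)%type T M :=
  [ffun p => if p.2 is Some b then
               if v (p.1, b) is Some t then inl t else inr p.1
             else inr p.1].

(** The line [l] of that subspace, as a word over [option T] with the letter
    [None] for the wildcard. *)
Definition block_line v : word (M * option B)%type S :=
  [ffun p => if p.2 is Some b then
               if v (p.1, b) is Some t then Some t else l p.1
             else l p.1].

Definition set_block v w : word (M * B)%type S :=
  [ffun p => if p.1 == r0 then w p.2 else v p].

Lemma collapse_block_line v t :
  collapse t (block_line v) =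
    [ffun p => Some (sub_pt (block_template v) (line_pt l t) p)].
Proof.
apply/ffunP => -[r [b|]]; rewrite !ffunE /= ?ffunE //.
by case: (v (r, b)) => //=; rewrite ffunE.
Qed.

(** A random word stays random when its block of [r0] is drawn again: exchanging
    the old block with the new one is an involution. *)
Lemma avg_set_block (f : word (M * B)%type S -> R) :
  avg f = avg (fun v => avg (fun w => f (set_block v w))).
Proof.
pose h p : word (M * B)%type S * word B S :=
  (set_block p.1 p.2, [ffun b => p.1 (r0, b)]).
have h_bij : bijective h.
  apply: inv_bij => -[v w]; congr (_, _); apply/ffunP.
    by move=> [r b]; rewrite !ffunE /=; case: eqP => // ->.
  by move=> b; rewrite !ffunE /= eqxx.
rewrite -(avg_pair (fun p => f (set_block p.1 p.2))).
rewrite -(avg_bij (fun p => f p.1) h_bij) avg_pair; apply: eq_avg => v /=.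
by rewrite avg_cst // word_card_gt0 // card_option.
Qed.

End Blocks.

Hypothesis T_gt0 : (0 < #|T|)%N.
Hypothesis dhjT : DHJ R T.

Variable delta : R.
Hypothesis delta_gt0 : 0 < delta.
Hypothesis dhjS : forall eps, 0 < eps -> exists I, DHJ_on S (delta + eps) I.

(** A line-free set is denser than [delta] on the complement of an intersection
    of insensitive sets.  Every section of [A] at a word [y] over [J] has almost
    density [delta]; so, for each [block_template], the theorem over [T] gives
    lines in [A], and one line [l] occurs with positive probability [theta].
    Letting the block of a wildcard of [l] vary freely gives the cube of words
    over [B], which may be chosen large after [theta]. *)
Lemma correlation : exists2 gamma : R, 0 < gamma & forall B : finType,
  exists2 eps : R, 0 < eps & exists I : finType, forall A : word I S -> bool,
    ~ has_line A -> delta - eps <= avg (fun x => (A x)%:R) ->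
    exists (A' : word B S -> bool) (D : T -> word B S -> bool),
      [/\ ~ has_line A', forall t, insensitive t (D t),
          forall w, A' w -> ~~ [forall t, D t w] &
          delta * (1 - avg (fun w => [forall t, D t w]%:R)) + gamma
            <= avg (fun w => (A' w)%:R)].
Proof.
have S0 : (0 < #|{: S}|)%N by rewrite card_option.
have d0 := delta_gt0; have d4 : 0 < delta / 2 / 2 by lra.
have [M dhjM] := dhjT d4.
have L0 : (0 < #|word M S|)%N by exact: word_card_gt0.
pose theta := Num.min 1 (delta / 2 / 2 / #|word M S|%:R).
have th0 : 0 < theta by rewrite lt_min ltr01 divr_gt0 // ltr0n.
have th1 : theta <= 1 by rewrite ge_min lexx.
have dth0 : 0 < delta * theta by rewrite mulr_gt0.
exists (delta * theta / 2) => [|B]; first by rewrite divr_gt0.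
pose J := (M * option B)%type.
have Y0 : (0 < #|word J S|)%N by exact: word_card_gt0.
(* Small enough for the loss in [ge_of_avg_ge], a factor [2 * #|word J S|], to
   be at most half of the gain [delta * theta]. *)
pose eps := delta * theta / 4 / #|word J S|%:R.
have e0 : 0 < eps by rewrite !divr_gt0 // ltr0n.
exists eps => //.
have [K dhjK] := dhjS e0; exists (J + K)%type => A nA; rewrite avg_glue => dA.
have dense y : delta - delta * theta / 2 <= avg (fun z => (A (glue y z))%:R).
  have := @ge_of_avg_ge R _ (fun y => avg (fun z => (A (glue y z))%:R)) delta eps.
  move=> /(_ _ dA y); rewrite /eps mulrA divfK ?pnatr_eq0 -?lt0n //.
  rewrite (_ : 2 * (delta * theta / 4) = delta * theta / 2); last by field.
  apply=> y'; apply: (line_free_avg_le dhjK) => /has_line_section; exact: nA.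
have dense2 y : delta / 2 <= avg (fun z => (A (glue y z))%:R).
  by apply: le_trans (dense y); have := ler_piMr (ltW delta_gt0) th1; lra.
pose V := word (M * B)%type S.
have VZ0 : (0 < #|{: V * word K S}|)%N.
  by rewrite card_prod muln_gt0 !word_card_gt0.
pose good (l : word M S) (p : V * word K S) :=
  [exists r, l r == None] &&
  [forall t, A (glue (collapse t (block_line l p.1)) p.2)].
pose a (p : V * word K S) : R := avg (fun w : word M T =>
  (A (glue [ffun q => Some (sub_pt (block_template p.1) w q)] p.2))%:R).
have [|||p|l l_popular] := @popular_witness R _ _ good a (delta / 2).
- by rewrite divr_gt0.
- by move=> p; apply: avg_le1 => w; exact: indic_le1.
- rewrite avg_pair -(@avg_cst R V (delta / 2)) ?word_card_gt0 //.
  apply: avg_le => v; rewrite /a /= avg_exchange.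
  rewrite -(@avg_cst R (word M T) (delta / 2)) ?word_card_gt0 //.
  by apply: avg_le => w; exact: dense2.
- move=> /dhjM[l [[r lr] lA]]; exists l; apply/andP; split.
    by apply/existsP; exists r; rewrite lr.
  by apply/forallP => t; rewrite collapse_block_line.
have {}l_popular : theta <= avg (fun p => (good l p)%:R : R).
  by apply: le_trans l_popular; rewrite ge_min lexx orbT.
have [r0 lr0] : exists r, l r = None.
  have := lt_le_trans th0 l_popular; rewrite /good.
  case: existsP => [[r /eqP]|_] /=; first by exists r.
  by rewrite avg_cst ?ltxx.
(* A choice of [v] and [z] for which [F] is at least its average makes [A] dense
   relative to the complement of the intersection of the [D t]. *)
pose F (p : V * word K S) : R := (A (glue (block_line l p.1) p.2))%:R +
  delta * [forall t, A (glue (collapse t (block_line l p.1)) p.2)]%:R.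
have F_big : delta + delta * theta / 2 <= avg F.
  rewrite /F avgD avgZ.
  have : delta * theta <= delta * avg (fun p : V * word K S =>
      [forall t, A (glue (collapse t (block_line l p.1)) p.2)]%:R).
    rewrite ler_wpM2l ?(ltW delta_gt0) //; apply: le_trans l_popular _.
    by apply: avg_le => p; rewrite /good ler_nat; case: (_ && _) /andP => // -[_ ->].
  have : delta - delta * theta / 2 <=
      avg (fun p : V * word K S => (A (glue (block_line l p.1) p.2))%:R).
    rewrite avg_pair -(@avg_cst R V (delta - _)) ?word_card_gt0 //.
    by apply: avg_le => v; exact: (dense (block_line l v)).
  lra.
rewrite avg_pair (avg_set_block r0) in F_big.
have [v F_v] := avg_attained (word_card_gt0 _ S0) F_big.
rewrite avg_exchange in F_v.
have [z] := avg_attained (word_card_gt0 _ S0) F_v.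
rewrite /F avgD avgZ /=.
pose X w := block_line l (set_block r0 v w).
pose A' w := A (glue (X w) z).
pose D t w := A (glue (collapse t (X w)) z).
rewrite -/(avg (fun w => (A' w)%:R)) => F_vz.
exists A', D; split.
- (* [A'] is the trace of [A] on a subspace. *)
  pose chi : template (J + K)%type S B := [ffun i => match i with
    | inl p => if p.2 is Some b then
                 if p.1 == r0 then inr b else inl (X [ffun => None] p)
               else inl (X [ffun => None] p)
    | inr i => inl (z i) end].
  have chiB : onto chi.
    by apply/ontoP => b; exists (inl (r0, Some b)); rewrite ffunE /= eqxx.
  have -> : A' = fun w => A (sub_pt chi w).
    apply/funext => w; congr A; apply/ffunP => -[[r [b|]]|i]; rewrite !ffunE //=.
    have [->|/negPf nr] := eqVneq r r0; rewrite !ffunE /= ?eqxx ?nr ?lr0 //.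
    by case: (w b).
  by move/(has_line_sub_pt chiB).
- move=> t w; congr (A (glue _ z)); apply/ffunP => -[r [b|]]; rewrite !ffunE //=.
  have [->|/negPf nr] := eqVneq r r0; rewrite ?ffunE /= ?eqxx ?nr ?lr0 //.
  by case: (w b).
- (* Otherwise [X w], read as a line with the wildcard [None], is in [A]: its
     point at [None] is [X w] itself. *)
  move=> w A'w; apply/negP => /forallP Dw; apply: nA.
  have X0 : X w (r0, None) = None by rewrite ffunE.
  have {}Dw t : A (glue (collapse t (X w)) z) := Dw t.
  have {}A'w : A (glue (X w) z) := A'w.
  move: (X w) A'w Dw X0 => x Ax Dx x0.
  exists [ffun i => match i with
    | inl p => if x p is Some s then Some (Some s) else None
    | inr i => Some (z i) end]; split.
    by exists (inl (r0, None)); rewrite ffunE x0.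
  case=> [t|].
    have := Dx t; congr A; apply/ffunP => -[p|i]; rewrite !ffunE //.
    by case: (x p).
  move: Ax; congr A; apply/ffunP => -[p|i]; rewrite !ffunE //.
  by case: (x p).
- rewrite /A' /D /X; lra.
Qed.

(** The indicator of [A'] minus a little more than [delta] has a nonpositive
    average on all subspaces of a given dimension, hence almost so on each
    intersection of insensitive sets.  The complement of the intersection of
    the [D t] is the union of such intersections, one for each pattern of
    memberships in the [D t] other than the constant [true]. *)
Lemma density_decrement : exists2 eps : R, 0 < eps &
  exists I, DHJ_on S (delta - eps) I.
Proof.
have d0 := delta_gt0; have [gamma g0 corr] := correlation.
have g4 : 0 < gamma / 4 by rewrite divr_gt0.
have [M dhjM] := dhjS g4.
pose q := #|{ffun T -> bool}|.
have q0 : (0 < q)%N by rewrite /q card_ffun card_bool expn_gt0.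
pose e := Num.min 1 (gamma / 4 / q%:R).
have e0 : 0 < e by rewrite lt_min ltr01 divr_gt0 // ltr0n.
have e1 : e <= 1 by rewrite ge_min lexx.
have [B HB] := insensitive_inter_avg_le T_gt0 dhjT (enum T) M e0 e1.
have [eps eps0 [I HI]] := corr B; exists eps => //; exists I => A dA.
apply: contrapT => nA.
have [A' [D [nA' insD A'D dA']]] := HI A nA dA.
pose f w : R := (A' w)%:R - (delta + gamma / 4).
have f1 w : f w <= 1 by rewrite /f; have := indic_le1 R (A' w); lra.
have f0 : nonpos_on_subspaces M f.
  move=> phi phiM; rewrite /f avgD avg_cst; last first.
    by apply: word_card_gt0; rewrite card_option.
  rewrite subr_le0; apply: (line_free_avg_le dhjM).
  by move/(has_line_sub_pt phiM).
pose N w : R := (~~ [forall t, D t w])%:R.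
have le_Nf : avg (fun w => N w * f w) <= gamma / 4.
  pose E (pat : {ffun T -> bool}) t w := D t w == pat t.
  have Ef pat : avg (fun w => (all (E pat ^~ w) (enum T))%:R * f w) <= e.
    by apply: HB => // t w; rewrite /E insD.
  pose G pat w := (pat != [ffun => true])%:R * ((all (E pat ^~ w) (enum T))%:R * f w).
  have -> : avg (fun w => N w * f w) = \sum_pat avg (G pat).
    rewrite -avg_sum; apply: eq_avg => w /=.
    pose p0 := [ffun t => D t w].
    have allE pat : all (E pat ^~ w) (enum T) = (pat == p0).
      apply/allP/eqP => [Ep|-> t _]; last by rewrite /E ffunE.
      apply/ffunP => t; rewrite ffunE; apply/esym/eqP/Ep.
      by rewrite mem_enum.
    rewrite (bigD1 p0) //= big1 => [|pat /negPf np]; last first.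
      by rewrite /G allE np mul0r mulr0.
    rewrite addr0 /G allE eqxx mul1r /N.
    have -> : (p0 != [ffun => true]) = ~~ [forall t, D t w].
      congr negb; apply/eqP/forallP => [/ffunP p0T t|DT].
        by have := p0T t; rewrite !ffunE.
      by apply/ffunP => t; rewrite !ffunE; exact: DT.
    by [].
  apply: (@le_trans _ _ (\sum_(pat : {ffun T -> bool}) e)).
    apply: ler_sum => pat _; rewrite avgZ.
    by case: (pat != _); rewrite ?mul1r ?mul0r // ltW.
  rewrite sumr_const -[e *+ _]mulr_natr -/q -ler_pdivlMr ?ltr0n //.
  by rewrite ge_min lexx orbT.
have N_A' : avg (fun w => N w * f w) =
    avg (fun w => (A' w)%:R) - (delta + gamma / 4) * avg N.
  rewrite -avgZ -avgN -avgD; apply: eq_avg => w; rewrite /f mulrBr.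
  congr (_ - _); last exact: mulrC.
  rewrite /N; case A'w: (A' w); last by rewrite mulr0.
  by rewrite A'D // mulr1.
have N1 : avg N <= 1 by apply: avg_le1 => w; exact: indic_le1.
have ND : avg N = 1 - avg (fun w => [forall t, D t w]%:R).
  rewrite -[X in _ = X - _](@avg_cst _ (word B S)); last first.
    by apply: word_card_gt0; rewrite card_option.
  rewrite -avgN -avgD; apply: eq_avg => w; rewrite /N.
  by case: [forall _, _]; rewrite ?subrr ?subr0.
rewrite -ND in dA'; nra.
Qed.
End Step.

(** If the infimum of the densities that force a line were positive, then by
    [density_decrement] a smaller density would force a line too. *)
Lemma DHJ_option (R : realType) (T : finType) :
  (0 < #|T|)%N -> DHJ R T -> DHJ R (option T).
Proof.
move=> T0 dhjT delta d0.
pose E (e : R) : Prop := 0 <= e /\ exists I, DHJ_on (option T) e I.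
have E2 : E 2.
  split=> //; exists void => A /le_trans/(_ (avg_le1 (fun=> indic_le1 R _))).
  by rewrite leNgt ltr1n.
have E0 : classical_sets.lbound E 0 by move=> e [].
have infE : classical_sets.has_inf E by split; [exists 2 | exists 0].
have [le0|gt0] := lerP (inf E) 0.
  have [e [_ [I dhjI]] lt_e] := inf_adherent d0 infE.
  exists I; apply: DHJ_on_le dhjI; lra.
have near eps : 0 < eps -> exists I, DHJ_on (option T) (inf E + eps) I.
  move=> e0; have [e [_ [I dhjI]] lt_e] := inf_adherent e0 infE.
  by exists I; apply: DHJ_on_le dhjI; exact: ltW.
have [eps e0 [I dhjI]] := density_decrement T0 dhjT gt0 near.
pose e := Num.max 0 (inf E - eps).
have Ee : E e.
  split; first by rewrite le_max lexx.
  by exists I; apply: DHJ_on_le dhjI; rewrite le_max lexx orbT.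
have := ge_inf infE.2 Ee; rewrite /e le_max; lra.
Qed.

(** An alphabet of [k.+1] letters, built by the constructor of the induction. *)
Fixpoint letters (k : nat) : finType := if k is k.+1 then option (letters k) else unit.

Theorem density_Hales_Jewett (R : realType) (k : nat) : DHJ R (letters k).
Proof.
elim: k => [|k IHk] /=; last first.
  apply: DHJ_option IHk; case: k => [|k] /=; first by rewrite card_unit.
  by rewrite card_option.
move=> delta d0; exists unit => A dA; have [|x] := avg_attained _ dA.
  by rewrite word_card_gt0 // card_unit.
case Ax: (A x); last by rewrite mulr0n leNgt d0.
exists [ffun => None]; split; first by exists tt; rewrite ffunE.
move=> t; move: Ax; congr (A _ = _); apply/ffunP => i.
by case: (x i) (line_pt _ t i) => -[].
Qed.

(** * Arithmetic progressions *)

Fixpoint letter_val (k : nat) : letters k -> nat :=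
  if k is k.+1 then fun l => if l is Some l' then (letter_val l').+1 else 0%N
  else fun=> 0%N.

Lemma letter_val_le k (l : letters k) : (letter_val l <= k)%N.
Proof. by elim: k l => [|k IHk] //= [l|]; rewrite ?ltnS ?IHk. Qed.

Lemma letter_val_surj k j : (j <= k)%N -> exists l : letters k, letter_val l = j.
Proof.
elim: k j => [|k IHk] [|j] //=; first by exists None.
by rewrite ltnS => /IHk[l <-]; exists (Some l).
Qed.

Lemma sum_shift_ge (A : nat -> bool) n s :
  (\sum_(i < n) A i <= \sum_(i < n) A (i + s) + s)%N.
Proof.
apply: (@leq_trans (\sum_(i < n + s) A i)); first by rewrite big_split_ord leq_addr.
rewrite (addnC n s) big_split_ord [leqRHS]addnC; apply: leq_add.
  rewrite -[leqRHS]card_ord -sum1_card; apply: leq_sum => i _; exact: leq_b1.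
by apply: leq_sum => i _; rewrite (addnC i).
Qed.

(** The sum of the letters of a word maps a combinatorial line with [r]
    wildcards to an arithmetic progression of common difference [r]. *)
Theorem Szemeredi (R : realType) (k : nat) (delta : R) : 0 < delta ->
  exists N : nat, forall n, (N <= n)%N -> forall A : nat -> bool,
    delta * n%:R <= (\sum_(i < n) A i)%:R ->
    exists a r, (0 < r)%N /\
      forall j, (j <= k)%N -> A (a + j * r)%N /\ (a + j * r < n)%N.
Proof.
move=> d0; have d2 : 0 < delta / 2 by lra.
have [I dhj] := density_Hales_Jewett k d2.
have T0 : (0 < #|letters k|)%N.
  by case: k {dhj} => [|k]; rewrite ?card_unit ?card_option.
pose L := (#|I| * k)%N.
exists (Num.bound (L%:R / (delta / 2))).+1 => n leNn A dA.
have n0 : (0 < n)%N by apply: leq_trans leNn.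
have nR : 0 < n%:R :> R by rewrite ltr0n.
have L_small : L%:R <= delta / 2 * n%:R.
  rewrite mulrC -ler_pdivrMr //; apply/ltW.
  apply: lt_le_trans (archi_boundP _) _; first by rewrite divr_ge0 // ltW.
  by rewrite ler_nat ltnW.
pose s (x : word I (letters k)) := (\sum_i letter_val (x i))%N.
have sL x : (s x <= L)%N.
  rewrite /L -sum_nat_const; apply: leq_sum => i _; exact: letter_val_le.
pose A' i := A i && (i < n)%N.
have [a da] : exists a : 'I_n, delta / 2 <= avg (fun x => (A' (a + s x)%N)%:R).
  apply: avg_attained; first by rewrite card_ord.
  rewrite avg_exchange -(@avg_cst R (word I (letters k)) (delta / 2)); last first.
    exact: word_card_gt0.
  apply: avg_le => x; rewrite /avg card_ord ler_pdivlMr // -natr_sum.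
  have : (\sum_(i < n) A i <= \sum_(i < n) A' (i + s x)%N + L)%N.
    rewrite (eq_bigr (fun i : 'I_n => A' i : nat)) => [|i _]; last first.
      by rewrite /A' ltn_ord andbT.
    by apply: leq_trans (sum_shift_ge A' n (s x)) _; rewrite leq_add2l.
  rewrite -(ler_nat R) natrD; lra.
have [l [[i0 li0] lA]] := dhj _ da.
pose f := (\sum_(i | l i != None) odflt 0 (omap (@letter_val k) (l i)))%N.
pose r := #|[pred i | l i == None]|.
have s_line t : (s (line_pt l t) = f + letter_val t * r)%N.
  rewrite /s (bigID (fun i => l i != None)) /=; congr (_ + _)%N.
    by apply: eq_bigr => i; rewrite ffunE; case: (l i).
  rewrite mulnC -sum_nat_const; apply: eq_big => [i|i /negPn/eqP li].
    by rewrite negbK inE.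
  by rewrite ffunE li.
exists (a + f)%N, r; split.
  by apply/card_gt0P; exists i0; rewrite inE li0.
move=> j /letter_val_surj[t <-]; have := lA t.
by rewrite s_line addnA => /andP.
Qed.

(** * Dense subsets of a regular tree *)

Section Tree.
Variables (R : realType) (L : finType).
Implicit Types (H : seq L -> bool) (sg : seq bool).

Definition subtree H (l : L) : seq L -> bool := fun x => H (l :: x).

(** [sg] marks levels of the tree of words over [L]; it is realized by [H] when
    the marked levels are the levels of a replica contained in [H]. *)
Fixpoint realized sg H : bool :=
  if sg is s :: sg' then
    if s then H [::] && [forall l, realized sg' (subtree H l)]
    else [exists l, realized sg' (subtree H l)]
  else true.

(** A realized marking stays realized with fewer marks, which are here those on
    an arithmetic progression: at the other levels the embedding takes one step
    towards any child below which the rest is realized. *)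
Lemma realized_embedding (r k : nat) sg H a : (0 < r)%N -> (0 < #|L|)%N ->
  realized sg H -> (forall j, (j <= k)%N -> nth false sg (a + j * r)%N) ->
  exists e : seq L -> seq L, forall x, (size x <= k)%N ->
    [/\ H (e x), size (e x) = (a + size x * r)%N &
        forall c, (size x < k)%N -> prefix (rcons (e x) c) (e (rcons x c))].
Proof.
move=> r0 L0; elim: sg H a k => [|s sg IH] H a k.
  by move=> _ /(_ 0%N isT); rewrite nth_nil.
case: a => [|a] real_sg marks.
  have := marks 0%N isT; case: s marks real_sg => //= marks /andP[H0 realL] _.
  case: k marks => [|k] marks.
    by exists (fun=> [::]) => -[|c x].
  have /fin_all_exists[e eP] l : exists e : seq L -> seq L, forall x, (size x <= k)%N ->
      [/\ subtree H l (e x), size (e x) = (r.-1 + size x * r)%N &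
      forall c, (size x < k)%N -> prefix (rcons (e x) c) (e (rcons x c))].
    apply: IH; first by move/forallP: realL.
    move=> j jk; have := marks j.+1 jk; rewrite add0n mulSn.
    by case: (r) r0.
  exists (fun x => if x is c :: x' then c :: e c x' else [::]) => -[|c x] /= xk.
    by split=> // c _; rewrite eqxx prefix0s.
  have [He se pe] := eP c x xk; split=> // [|c' xk']; last by rewrite eqxx pe.
  by rewrite se add0n mulSn -addSn prednK.
have [l real_l] : exists l, realized sg (subtree H l).
  case: s real_sg {marks} => /= [/andP[_ /forallP realL]|/existsP //].
  by case/card_gt0P: L0 => l _; exists l.
have [e eP] := IH _ a k real_l marks.
exists (fun x => l :: e x) => x xk; have [He se pe] := eP x xk; split=> //=.
  by rewrite se addSn.
by move=> c xk'; rewrite eqxx pe.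
Qed.

Fixpoint bits n : seq (seq bool) :=
  if n is n'.+1 then map (cons false) (bits n') ++ map (cons true) (bits n')
  else [:: [::]].

Lemma size_bits n sg : sg \in bits n -> size sg = n.
Proof.
elim: n sg => [|n IHn] sg /=; first by rewrite inE => /eqP->.
by rewrite mem_cat => /orP[] /mapP[sg' /IHn <- ->].
Qed.

Lemma sum_bits n (F : seq bool -> R) :
  \sum_(sg <- bits n.+1) F sg =
  \sum_(sg <- bits n) (F (false :: sg) + F (true :: sg)).
Proof. by rewrite big_cat !big_map big_split. Qed.

Lemma sum_bits_count n (y : R) :
  \sum_(sg <- bits n) y ^+ count id sg = (1 + y) ^+ n.
Proof.
elim: n => [|n IHn]; first by rewrite big_seq1.
rewrite sum_bits exprS -IHn mulr_sumr; apply: eq_bigr => sg _ /=.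
by rewrite add0n exprS mulrDl mul1r.
Qed.

(** The sum of the densities of [H] in the levels below [n]. *)
Fixpoint weight n H : R :=
  if n is n'.+1 then (H [::])%:R + avg (fun l => weight n' (subtree H l)) else 0.

Hypothesis L_ge2 : (2 <= #|L|)%N.
Local Notation beta := (#|L|%:R : R).
Local Notation p := (1 - beta^-1).
Local Notation w := ((beta - 1)^-1).

Let L_gt0 : (0 < #|L|)%N.
Proof. exact: ltnW. Qed.

Let beta_ge2 : 2 <= beta.
Proof. by rewrite ler_nat. Qed.

Let beta_inv : 0 < beta^-1 /\ beta^-1 <= 2^-1.
Proof.
have := beta_ge2 => b2; have b0 : 0 < beta by lra.
by rewrite invr_gt0 lef_pV2 ?posrE.
Qed.

(** The average over the branches of depth [n] of [p ^- c], where [c] is the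
    number of vertices of [H] on the branch. *)
Fixpoint branch_avg n H : R :=
  if n is n'.+1 then
    (if H [::] then p^-1 else 1) * avg (fun l => branch_avg n' (subtree H l))
  else 1.

Lemma weight_ge0 n H : 0 <= weight n H.
Proof. by elim: n H => //= n IHn H; rewrite addr_ge0 // avg_ge0. Qed.

(** Bernoulli's inequality at the nodes of the tree: it stands in for the
    convexity of the exponential function. *)
Lemma branch_avg_ge n H (h : nat) :
  1 + (weight n H - h%:R) * beta^-1 <= p ^+ h * branch_avg n H.
Proof.
have [b0 b1] := beta_inv; have p0 : 0 < p by lra.
have p1 : p * p^-1 = 1 by rewrite divff ?gt_eqF.
elim: n H h => [|n IHn] H h /=.
  rewrite mulr1 sub0r; elim: h => [|h IHh]; first by rewrite expr0 oppr0 mul0r addr0.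
  have h0 : 0 <= h%:R :> R by [].
  rewrite exprS -natr1; nra.
have IHa h' : 1 + (avg (fun l => weight n (subtree H l)) - h'%:R) * beta^-1 <=
    p ^+ h' * avg (fun l => branch_avg n (subtree H l)).
  rewrite -avgZ; apply: le_trans (avg_le (fun l => IHn (subtree H l) h')).
  rewrite avgD avg_cst // [leRHS](_ : _ = 1 + beta^-1 * avg (fun l =>
    weight n (subtree H l) + - h'%:R)).
    by rewrite avgD avg_cst // mulrC.
  by rewrite -avgZ; congr (_ + _); apply: eq_avg => l; rewrite mulrC.
case: (H [::]) => /=; last by rewrite add0r mul1r; exact: IHa.
case: h => [|h].
  have := IHa 0%N; rewrite !expr0 !mul1r !subr0.
  set a := avg _; set b := avg _ => ab.
  have a0 : 0 <= a by apply: avg_ge0 => l; exact: weight_ge0.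
  have q1 : 1 + beta^-1 <= p^-1.
    rewrite -[leRHS]mul1r ler_pdivlMr //; nra.
  have q0 : 0 <= a * beta^-1 by rewrite mulr_ge0 // ltW.
  nra.
rewrite exprSr -mulrA [p * (_ * _)]mulrA p1 mul1r.
by apply: le_trans (IHa h); rewrite -natr1; lra.
Qed.

(** A marking of the levels below the root is realized together with the root
    if it is realized below each of the [beta] children, and without the root
    if it is realized below one of them.  If it is realized below [c] children
    then the two cases contribute at least [c / (beta - 1)]. *)
Lemma branch_avg_le n H :
  branch_avg n H <=
  \sum_(sg <- bits n) (realized sg H)%:R * w ^+ count id sg.
Proof.
have b2 := beta_ge2; have [b0 b1] := beta_inv.
elim: n H => [|n IHn] H /=; first by rewrite big_seq1 expr0 mulr1.
set q := if H [::] then _ else _.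
have q0 : 0 <= q by rewrite /q; case: ifP => // _; rewrite invr_ge0; lra.
rewrite -/(bits n.+1) sum_bits.
apply: (@le_trans _ _ (q * avg (fun l => \sum_(sg <- bits n)
    (realized sg (subtree H l))%:R * w ^+ count id sg))).
  by rewrite ler_wpM2l // avg_le.
rewrite /avg exchange_big /= mulr_suml mulr_sumr; apply: ler_sum => sg _.
rewrite -mulr_suml add0n exprS.
pose c := #|[pred l | realized sg (subtree H l)]|.
have -> : \sum_l (realized sg (subtree H l))%:R = c%:R :> R.
  by rewrite -natr_sum /c -sum1_card [in RHS]big_mkcond; congr (_%:R).
have w0 : 0 <= w ^+ count id sg by rewrite exprn_ge0 // invr_ge0; lra.
have existsE : [exists l, realized sg (subtree H l)] = (0 < c)%N.
  by apply/existsP/card_gt0P => -[l ?]; exists l.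
have forallE : [forall l, realized sg (subtree H l)] = (c == #|L|).
  apply/forallP/eqP => [realL|cL l]; first by apply: eq_card => l; rewrite inE realL.
  have /subset_cardP/(_ (subset_predT _))/(_ l) := cL.
  by rewrite !inE.
rewrite existsE forallE.
suff : q * (c%:R / beta) <= (0 < c)%N%:R + (H [::] && (c == #|L|))%:R * w.
  move=> le_c; have := ler_wpM2r w0 le_c; congr (_ <= _); first by ring.
  by rewrite mulrDl mulrA.
have c_le : (c <= #|L|)%N by exact: max_card.
have c_leR : c%:R <= beta by rewrite ler_nat.
have [->|c0] := posnP c; first by rewrite mul0r mulr0 addr_ge0 ?mulr_ge0 ?invr_ge0 //; lra.
rewrite /q; case: (H [::]) => /=; last first.
  by rewrite mul0r addr0 mul1r ler_pdivrMr ?mul1r //; lra.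
have -> : p^-1 * (c%:R / beta) = c%:R * w.
  by field; rewrite !gt_eqF //; lra.
have [->|ne_c] := eqVneq c #|L|.
  rewrite le_eqVlt; apply/orP; left; apply/eqP; rewrite mul1r.
  by field; lra.
rewrite mul0r addr0 ler_pdivrMr ?mul1r; last lra.
rewrite lerBrDr natr1 ler_nat ltn_neqAle ne_c //.
Qed.

Lemma pow_1D_le (x : R) q : 0 <= x -> q%:R * x <= beta^-1 ->
  (1 + x) ^+ q <= p^-1.
Proof.
move=> x0 qx; have [b0 b1] := beta_inv; have p0 : 0 < p by lra.
have bern n : (1 + x) ^+ n * (1 - n%:R * x) <= 1.
  elim: n => [|n IHn]; first by rewrite expr0 mul0r subr0 mulr1.
  apply: le_trans IHn; rewrite exprSr -mulrA ler_wpM2l ?exprn_ge0 //; first lra.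
  have n0 : 0 <= n%:R :> R by [].
  rewrite -natr1; nra.
rewrite -[leRHS]mul1r ler_pdivlMr //; apply: le_trans (bern q).
by rewrite ler_wpM2l ?exprn_ge0 //; lra.
Qed.

(** The markings with few marked levels carry little weight (Chernoff's bound),
    whereas by [branch_avg_ge] and [branch_avg_le] the realized markings of a
    dense set carry much; so a realized marking has many marked levels, and Szemeredi's
    theorem applies to them. *)
Lemma realized_progression (k : nat) (delta : R) : 0 < delta ->
  exists2 n : nat, (0 < n)%N & forall H, delta * n%:R <= weight n H ->
    exists sg a r, [/\ realized sg H, (0 < r)%N &
      forall j, (j <= k)%N -> nth false sg (a + j * r)%N].
Proof.
move=> d0; have b2 := beta_ge2; have [b0 b1] := beta_inv.
have p0 : 0 < p by lra.
have p1 : p < 1 by lra.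
(* With [m] the number of marked levels to be reached and [P = p ^ (r.+1 * m)],
   the realized markings have total weight at least [P ^- 3], as [H] has density
   at least [3 / q]; those with fewer than [m] marks have total weight at most
   [P ^- 2]: one factor is [y ^- m], the other bounds [(1 + w * y) ^+ n]. *)
pose q := (Num.bound (3 / delta)).+1.
have q_big : 3 <= delta * q%:R.
  rewrite mulrC -ler_pdivrMr //; apply/ltW; apply: lt_le_trans (archi_boundP _) _.
    by rewrite divr_ge0 // ltW.
  by rewrite ler_nat.
have q0 : 0 < q%:R :> R by rewrite ltr0n.
have bi1 : beta^-1 <= 1 by lra.
have [r r_small] := pow_small b0 bi1 (divr_gt0 b0 q0).
pose y := p ^+ r.+1.
have y0 : 0 < y by rewrite exprn_gt0.
have y_small : (1 + w * y) ^+ q <= p^-1.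
  apply: pow_1D_le; first by rewrite mulr_ge0 ?invr_ge0 ?ltW //; lra.
  rewrite mulrC -ler_pdivlMr //; apply: le_trans r_small.
  have w1 : w <= 1 by rewrite invf_le1; lra.
  have w0 : 0 <= w by rewrite invr_ge0; lra.
  have pr0 : 0 <= p ^+ r by rewrite exprn_ge0 // ltW.
  have wp : w * p <= 1 by nra.
  by rewrite /y exprS mulrA ler_piMl.
have e0 : 0 < (q * r.+1)%N%:R^-1 :> R by rewrite invr_gt0 ltr0n.
have [N szN] := Szemeredi k e0.
pose m := N.+1; pose n := (q * r.+1 * m)%N.
exists n => // H dH.
have [sg [sg_bits real_sg big_sg]] : exists sg,
    [/\ sg \in bits n, realized sg H & (m <= count id sg)%N].
  have [/hasP[sg sg_n /andP[real_sg big_sg]]|/hasPn small] :=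
    boolP (has (fun sg => realized sg H && (m <= count id sg)%N) (bits n)).
    by exists sg.
  pose h := (3 * (r.+1 * m))%N.
  have lower : 1 <= p ^+ h * branch_avg n H.
    apply: le_trans (branch_avg_ge n H h).
    rewrite lerDl mulr_ge0 ?(ltW b0) // subr_ge0; apply: le_trans dH.
    by rewrite /h /n -mulnA 2![(_ * (r.+1 * m))%N%:R]natrM [leRHS]mulrA ler_wpM2r.
  have upper : y ^+ m * branch_avg n H <= (1 + w * y) ^+ n.
    have w0 : 0 <= w by rewrite invr_ge0; lra.
    have ym0 : 0 <= y ^+ m by rewrite exprn_ge0 // ltW.
    apply: le_trans (ler_wpM2l ym0 (branch_avg_le n H)) _.
    rewrite -sum_bits_count mulr_sumr big_seq [leRHS]big_seq.
    apply: ler_sum => sg /small; rewrite negb_and -ltnNge.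
    have wc0 : 0 <= w ^+ count id sg by rewrite exprn_ge0.
    case real_sg : (realized sg H) => /= few; last first.
      by rewrite mul0r mulr0 exprn_ge0 // mulr_ge0 // ltW.
    rewrite mul1r exprMn mulrC ler_wpM2l //.
    have y1 : y <= 1 by rewrite exprn_ile1 // ltW.
    by rewrite ler_wiXn2l ?(ltW y0) // ltnW.
  have {}upper : y ^+ m * branch_avg n H <= p^-1 ^+ (r.+1 * m).
    apply: le_trans upper _; rewrite /n -mulnA exprM.
    by rewrite lerXn2r ?nnegrE ?exprn_ge0 ?invr_ge0 ?(ltW p0) // addr_ge0 //
      mulr_ge0 ?invr_ge0 ?(ltW y0) //; lra.
  have ph : p ^+ h = (p ^+ (r.+1 * m)) ^+ 3 by rewrite /h mulnC exprM.
  rewrite exprVn /y -exprM ph in lower upper *.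
  set P := p ^+ (r.+1 * m) in lower upper; set b := branch_avg n H in lower upper.
  have P0 : 0 < P by rewrite exprn_gt0.
  have P1 : P < 1 by rewrite exprn_ilt1 // ltW.
  have : P ^+ 3 * b <= P.
    rewrite exprSr expr2 -!mulrA -[leRHS]mulr1 ler_wpM2l ?(ltW P0) //.
    by rewrite -(mulfV (lt0r_neq0 P0)) ler_wpM2l // ltW.
  lra.
have [||a [s [s0 marks]]] := szN n _ (nth false sg).
- by rewrite /n; apply: leq_trans (leqnSn N) (leq_pmull _ _).
- rewrite [n%:R]natrM mulKf ?pnatr_eq0 // ler_nat.
  apply: leq_trans big_sg _; rewrite -(size_bits sg_bits).
  rewrite (eq_bigr (fun i : 'I_(size sg) => nat_of_bool (nth false sg i))) //.
  rewrite -(big_mkord xpredT (fun i => nat_of_bool (nth false sg i))).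
  by rewrite -(big_nth false xpredT nat_of_bool) -sum1_count [leqLHS]big_mkcond.
exists sg, a, s; split=> // j jk; exact: (marks j jk).1.
Qed.

End Tree.

(** * Products of trees *)

Lemma card_dffun (I : finType) (T : I -> finType) :
  #|{dffun forall i, T i}| = (\prod_i #|T i|)%N.
Proof. by rewrite card_dep_ffun foldrE big_image. Qed.

Lemma card_family_prod (I : finType) (T : I -> finType) (F : forall i, pred (T i)) :
  #|(family F : simpl_pred {dffun forall i, T i})| = (\prod_i #|F i|)%N.
Proof. by rewrite card_family foldrE big_image. Qed.

Lemma avg_tuple_cons (R : realType) (L : finType) t (f : seq L -> R) :
  avg (fun x : t.+1.-tuple L => f x) =
  avg (fun l => avg (fun x : t.-tuple L => f (l :: x))).
Proof.
pose h (p : L * t.-tuple L) : t.+1.-tuple L := [tuple of p.1 :: p.2].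
rewrite (avg_bij (fun x : t.+1.-tuple L => f x) (h := h)) ?avg_pair //.
exists (fun x => (thead x, [tuple of behead x])) => [[l x]|x].
  by congr (_, _); apply: val_inj.
by rewrite /h /= [RHS]tuple_eta.
Qed.

Lemma weightE (R : realType) (L : finType) n (H : seq L -> bool) :
  weight R n H = \sum_(t < n) avg (fun x : t.-tuple L => (H x)%:R).
Proof.
elim: n H => [|n IHn] H; first by rewrite big_ord0.
rewrite big_ord_recl /=; congr (_ + _).
  rewrite (eq_avg (g := fun=> (H [::])%:R)) => [|x]; last by rewrite tuple0.
  by rewrite avg_cst // card_tuple.
rewrite (eq_avg (fun l => IHn (subtree H l))) avg_sum; apply: eq_bigr => t _.
by rewrite (avg_tuple_cons _ (fun x => (H x)%:R)).
Qed.

Section Diagonal.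
Variables (R : realType) (b d : nat) (n : 'I_d -> nat).
Hypothesis b_ge2 : (2 <= b)%N.
Variable H : {set Gamma b n}.
Local Notation L := {ffun 'I_d -> 'I_b}.

Definition base (i : 'I_d -> nat) := {dffun forall j, (i j).-tuple 'I_b}.

(** The vertex reached from [u] by the diagonal steps [x]; it lies in the
    product of trees only if [fits i x]. *)
Definition diag_path (i : 'I_d -> nat) (u : base i) (x : seq L) (j : 'I_d) :
    seq 'I_b :=
  u j ++ [seq (l : L) j | l <- x].

Definition diag_vertex i (u : base i) (x : seq L) : Gamma b n :=
  [ffun j => insub_bseq (n j) (diag_path u x j)].

Definition fits (i : 'I_d -> nat) (x : seq L) : bool :=
  [forall j, i j + size x <= n j]%N.

Definition diag_set i (u : base i) (x : seq L) : bool :=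
  fits i x && (diag_vertex u x \in H).

Lemma diag_vertexE i (u : base i) x j :
  fits i x -> diag_vertex u x j = diag_path u x j :> seq 'I_b.
Proof.
move=> /forallP/(_ j) le_ij; rewrite -[LHS]/(val _) ffunE val_insubd size_cat size_tuple size_map.
by rewrite le_ij.
Qed.

Lemma fits_prefix i x y : prefix x y -> fits i y -> fits i x.
Proof.
move=> /prefixP[z ->] /forallP fy; apply/forallP => j.
by apply: leq_trans (fy j); rewrite size_cat leq_add2l leq_addr.
Qed.

Definition level_density (i : 'I_d -> nat) : R :=
  #|[set x in H | level x == [ffun j => i j]]|%:R / b%:R ^+ (\sum_j i j)%N.

(** Each vertex of level [i + t] is reached from exactly one vertex of level [i]
    by [t] diagonal steps. *)
Lemma level_density_le i t :
  level_density (fun j => i j + t)%N <=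
  avg (fun u : base i => avg (fun x : t.-tuple L => (diag_set u x)%:R : R)).
Proof.
have b0 : (0 < b)%N by exact: ltnW.
rewrite -(avg_pair (fun p : base i * t.-tuple L => (diag_set p.1 p.2)%:R)).
have card_pairs : #|{: base i * t.-tuple L}| = (b ^ (\sum_j (i j + t)))%N.
  rewrite card_prod card_dffun card_tuple card_ffun card_ord.
  rewrite (eq_bigr (fun j => b ^ i j)%N) => [|j _]; last by rewrite card_tuple card_ord.
  rewrite -(big_morph (fun k => b ^ k)%N (expnD b) (expn0 b)).
  by rewrite -expnM -expnD big_split sum_nat_const card_ord.
rewrite /avg card_pairs natrX ler_wpM2r ?invr_ge0 ?exprn_ge0 //.
rewrite -natr_sum ler_nat.
pose c0 : 'I_b := Ordinal b0.
pose D := [set p : base i * t.-tuple L | diag_set p.1 p.2].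
have -> : (\sum_(p : base i * t.-tuple L) diag_set p.1 p.2 = #|D|)%N.
  by rewrite -sum1dep_card [RHS]big_mkcond.
apply: leq_trans (leq_imset_card (fun p : base i * t.-tuple L => diag_vertex p.1 p.2) D).
apply/subset_leq_card/subsetP => v; rewrite inE => /andP[vH /eqP/ffunP lev].
have size_v j : size (v j) = (i j + t)%N by have := lev j; rewrite !ffunE.
pose u : base i := [ffun j => [tuple nth c0 (v j) m | m < i j]].
pose x : t.-tuple L := [tuple [ffun j => nth c0 (v j) (i j + m)] | m < t].
have fx : fits i x.
  apply/forallP => j; rewrite size_tuple -size_v; exact: size_bseq.
have path_v j : diag_path u x j = v j.
  apply: (@eq_from_nth _ c0) => [|m].
    by rewrite size_cat size_map !size_tuple.
  rewrite size_cat size_map !size_tuple => lt_m.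
  rewrite nth_cat size_tuple ffunE; case: ltnP => [lt_mi|le_im].
    by rewrite -[m]/(nat_of_ord (Ordinal lt_mi)) -tnth_nth tnth_mktuple.
  have lt_mt : (m - i j < t)%N by rewrite ltn_subLR.
  rewrite (nth_map [ffun => c0]) ?size_tuple //.
  rewrite -[(m - i j)%N]/(nat_of_ord (Ordinal lt_mt)) -tnth_nth tnth_mktuple ffunE /=.
  by rewrite subnKC.
have vE : v = diag_vertex u x.
  by apply/ffunP => j; apply: val_inj; rewrite /= diag_vertexE.
by apply/imsetP; exists (u, x); rewrite // inE /diag_set /= fx -vE.
Qed.

Local Notation Box := {dffun forall j, 'I_(n j).+1}.

Lemma level_density_ge0 i : 0 <= level_density i.
Proof. by rewrite divr_ge0 ?exprn_ge0. Qed.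

Lemma level_density_le1 i : level_density i <= 1.
Proof.
have := level_density_le i 0; rewrite /level_density.
rewrite (eq_bigr i) => [|j _]; last by rewrite addn0.
have -> : [ffun j => i j + 0]%N = [ffun j => i j].
  by apply/ffunP => j; rewrite !ffunE addn0.
move=> /le_trans; apply; apply: avg_le1 => u; apply: avg_le1 => x; exact: indic_le1.
Qed.

Lemma densityE : density R H = avg (fun i : Box => level_density (fun j => i j)).
Proof.
rewrite /density /avg mulrC card_dffun; congr (_ / _%:R).
by apply: eq_bigr => j _; rewrite card_ord.
Qed.

Lemma avg_coord_lt (j0 : 'I_d) (t : nat) :
  avg (fun i : Box => (i j0 < t)%N%:R : R) <= t%:R / (n j0).+1%:R.
Proof.
pose F j : pred 'I_(n j).+1 := fun c => (j == j0) ==> (c < t)%N.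
have -> : avg (fun i : Box => (i j0 < t)%N%:R : R) =
    (\prod_j #|F j|)%N%:R / (\prod_j (n j).+1)%N%:R.
  rewrite /avg card_dffun -natr_sum; congr (_%:R / _%:R).
    rewrite -card_family_prod -sum1_card [RHS]big_mkcond; apply: eq_bigr => i _.
    have -> : (i \in family F) = (i j0 < t)%N.
      apply/familyP/idP => [/(_ j0)|it j]; first by rewrite unfold_in /F eqxx.
      by rewrite unfold_in /F; apply/implyP => /eqP ->.
    by case: (_ < _)%N.
  by apply: eq_bigr => j _; rewrite card_ord.
rewrite (bigD1 j0) //= [X in _ / X%:R](bigD1 j0) //= !natrM.
rewrite [X in _ * X%:R / _](eq_bigr (fun j => (n j).+1)) => [|j /negPf nj]; last first.
  by rewrite -[RHS]card_ord; apply: eq_card => c; rewrite unfold_in /F nj.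
have P0 : (0 < \prod_(j | j != j0) (n j).+1)%N by apply: prodn_gt0.
rewrite -mulf_div divff ?mulr1 ?pnatr_eq0 -?lt0n //.
rewrite ler_wpM2r ?invr_ge0 // ler_nat.
rewrite cardE -(size_map val) -[leqRHS](size_iota 0); apply: uniq_leq_size.
  by rewrite map_inj_uniq ?enum_uniq //; exact: val_inj.
move=> _ /mapP[c + ->]; rewrite mem_enum unfold_in /F eqxx mem_iota.
by rewrite add0n.
Qed.

(** Shifting all levels by [t] moves few of them out of the box, and the
    density of a level outside of the box is zero. *)
Lemma density_shift (t : nat) :
  density R H <= avg (fun i : Box => level_density (fun j => i j + t)%N) +
    \sum_j t%:R / (n j).+1%:R.
Proof.
pose ge_t (i : Box) := [forall j, t <= i j]%N.
pose sh (i : Box) : Box := [ffun j => inord (i j - t)].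
have shE (i : Box) j : ge_t i -> (sh i j + t)%N = i j.
  move=> /forallP/(_ j) le_ti; rewrite ffunE inordK ?subnK //.
  by apply: leq_ltn_trans (leq_subr _ _) (ltn_ord _).
have sh_inj : {in ge_t &, injective sh}.
  move=> i i' gi gi' eq_sh; apply/ffunP => j; apply: val_inj => /=.
  by rewrite -(shE i) // -(shE i') // eq_sh.
rewrite densityE.
apply: (@le_trans _ _ (avg (fun i : Box => (ge_t i)%:R * level_density (fun j => i j) +
    \sum_j (i j < t)%N%:R))).
  apply: avg_le => i; case: (boolP (ge_t i)) => [_|].
    by rewrite mul1r lerDl sumr_ge0.
  rewrite negb_forall => /existsP[j]; rewrite -ltnNge => ijt.
  rewrite mul0r add0r (bigD1 j) //= ijt; apply: le_trans (level_density_le1 _) _.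
  by rewrite lerDl sumr_ge0.
rewrite avgD avg_sum; apply: lerD; last by apply: ler_sum => j _; exact: avg_coord_lt.
rewrite ler_wpM2r ?invr_ge0 //.
rewrite (eq_bigr (fun i : Box => if ge_t i then level_density (fun j => sh i j + t)%N else 0)).
  rewrite -big_mkcond /= -(big_imset (fun i : Box => level_density (fun j => i j + t)%N) sh_inj).
  rewrite big_mkcond /=; apply: ler_sum => i _; case: ifP => // _.
  exact: level_density_ge0.
move=> i _; case: ifP => gi; rewrite ?mul0r // mul1r.
by congr level_density; apply: funext => j; rewrite shE.
Qed.

Lemma dense_diagonal_tree (m : nat) (delta : R) :
  (0 < d)%N -> (0 < m)%N -> delta <= density R H ->
  (forall j, d%:R * m%:R <= delta / 2 * (n j).+1%:R) ->
  exists i (u : base i), delta / 2 * m%:R <= weight R m (diag_set u).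
Proof.
move=> d0 m0 dH n_big.
have dense_t (t : 'I_m) : delta / 2 <=
    avg (fun i : Box => level_density (fun j => i j + t)%N).
  have := le_trans dH (density_shift t).
  suff : \sum_j t%:R / (n j).+1%:R <= delta / 2 by lra.
  have dR : 0 < d%:R :> R by rewrite ltr0n.
  apply: (@le_trans _ _ (\sum_(j < d) delta / 2 / d%:R)); last first.
    by rewrite sumr_const card_ord -[_ *+ _]mulr_natr divfK // gt_eqF.
  apply: ler_sum => j _; rewrite ler_pdivrMr ?ltr0n // mulrAC ler_pdivlMr //.
  apply: le_trans (n_big j); rewrite mulrC ler_wpM2l // ler_nat; exact: ltnW.
have [i di] : exists i : Box, delta / 2 * m%:R <=
    \sum_(t < m) level_density (fun j => i j + t)%N.
  apply: avg_attained.
    by rewrite card_dffun; apply: prodn_gt0 => j; rewrite card_ord.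
  rewrite avg_sum mulr_natr -[m in leLHS]card_ord -sumr_const.
  by apply: ler_sum => t _; exact: dense_t.
exists (fun j => i j); apply: avg_attained.
  rewrite card_dffun; apply: prodn_gt0 => j; rewrite card_tuple card_ord.
  by rewrite expn_gt0 (ltnW b_ge2).
rewrite (eq_avg (fun u => weightE R m (diag_set u))) avg_sum.
by apply: le_trans di _; apply: ler_sum => t _; exact: level_density_le.
Qed.

Lemma diagonal_replica (k r a : nat) i (u : base i) (e : seq L -> seq L) :
  (0 < r)%N ->
  (forall x, (size x <= k)%N ->
    [/\ diag_set u (e x), size (e x) = (a + size x * r)%N &
        forall c, (size x < k)%N -> prefix (rcons (e x) c) (e (rcons x c))]) ->
  exists S : {set Gamma b n}, arithmetic_replica k S /\ S \subset H.
Proof.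
move=> r0 eP.
have card_L : #|{: L}| = (b ^ d)%N by rewrite card_ffun !card_ord.
pose g (c : 'I_(b ^ d)) : L := enum_val (cast_ord (esym card_L) c).
have g_inj : injective g by move=> c c' /enum_val_inj/cast_ord_inj.
pose E (x : Tree (b ^ d) k) := e (map g x).
have size_x (x : Tree (b ^ d) k) : (size (map g x) <= k)%N.
  by rewrite size_map size_bseq.
have E_fits x : fits i (E x) by have [/andP[]] := eP _ (size_x x).
have E_H x : diag_vertex u (E x) \in H by have [/andP[]] := eP _ (size_x x).
have size_E (x : Tree (b ^ d) k) : size (E x) = (a + size x * r)%N.
  by have [_ ->] := eP _ (size_x x); rewrite size_map.
pose phi x := diag_vertex u (E x).
have level_phi x : level (phi x) = [ffun j => i j + (a + size x * r)]%N.
  apply/ffunP => j; rewrite [LHS]ffunE [RHS]ffunE diag_vertexE //.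
  by rewrite size_cat size_tuple size_map size_E.
exists [set phi x | x : Tree (b ^ d) k]; split; last first.
  by apply/subsetP => _ /imsetP[x _ ->]; exact: E_H.
exists phi; split=> //.
  split=> [x y eq_xy|x lt_xk]; first by rewrite !level_phi eq_xy.
  (* The image of a child of [x] lies below the diagonal child of [phi x] that
     is reached by one more step along the same path. *)
  pose f (y : Tree (b ^ d) k) := diag_vertex u (take (size (E x)).+1 (E y)).
  have childP y : tree_child x y -> exists2 c, val y = rcons x c &
      prefix (rcons (E x) (g c)) (E y).
    case/existsP => c /eqP yE; exists c => //.
    have [_ _ /(_ (g c))] := eP _ (size_x x).
    by rewrite size_map lt_xk -map_rcons -yE => /(_ isT).
  have fE y c : prefix (rcons (E x) (g c)) (E y) ->
      f y = diag_vertex u (rcons (E x) (g c)).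
    by move=> pre; rewrite /f -(size_rcons _ (g c)); case/prefixP: pre => z ->; rewrite take_size_cat.
  exists f; split.
    move=> y y' /childP[c yE py] /childP[c' yE' py'].
    rewrite (fE _ _ py) (fE _ _ py') => eq_f; apply: val_inj.
    rewrite yE yE'; congr rcons; apply: g_inj; apply/ffunP => j.
    have := congr1 (fun v : Gamma b n => bseqval (v j)) eq_f.
    rewrite /= !diag_vertexE; [|exact: fits_prefix (E_fits y')|exact: fits_prefix (E_fits y)].
    by rewrite /diag_path !map_rcons -!rcons_cat => /rcons_inj[].
  move=> y /childP[c yE py]; rewrite (fE _ _ py); split.
    apply/existsP; exists (g c); apply/forallP => j.
    rewrite /= !diag_vertexE ?(fits_prefix py) //.
    by rewrite /diag_path map_rcons rcons_cat.
  apply/forallP => j; rewrite /= !diag_vertexE ?(fits_prefix py) //.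
  by case/prefixP: py => z ->; rewrite /diag_path map_cat catA prefix_prefix.
exists (fun t : 'I_k.+1 => [ffun j => i j + (a + t * r)]%N); split.
  split=> [t t' lt_tt' j|x t size_xt]; last by rewrite level_phi size_xt.
  by rewrite !ffunE !ltn_add2l ltn_pmul2r.
exists (fun=> r); split=> // t j; rewrite !ffunE mul0n addn0; lia.
Qed.

End Diagonal.

Local Close Scope ring_scope.

Theorem theoremE (R : realType) (b d k : nat) (hb : 2 <= b) (hd : 1 <= d)
    (hk : 1 <= k) (delta : R) (hdelta : (0 < delta)%R) :
  exists N : nat, forall n : 'I_d -> nat, (forall j, N <= n j) ->
    forall H : {set Gamma b n}, (delta <= density R H)%R ->
      exists S : {set Gamma b n}, arithmetic_replica k S /\ S \subset H.
Proof.
have delta2 : (0 < delta / 2)%R by rewrite divr_gt0.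
have L_ge2 : 2 <= #|{ffun 'I_d -> 'I_b}|.
  rewrite card_ffun !card_ord -(prednK hd) expnS.
  by apply: leq_trans (hb) (leq_pmulr _ _); rewrite expn_gt0 (ltnW hb).
have [m m0 trees] := realized_progression L_ge2 k delta2.
exists (Num.bound (d%:R * m%:R / (delta / 2))%R) => n n_big H dH.
have n_bigR j : (d%:R * m%:R <= delta / 2 * (n j).+1%:R)%R.
  rewrite mulrC -[leRHS]mulrC mulrC -ler_pdivrMr //; apply/ltW.
  apply: lt_le_trans (archi_boundP _) _; last by rewrite ler_nat ltnW // ltnS.
  by apply: divr_ge0; [exact: mulr_ge0 | exact: ltW].
have [i [u dense_u]] := dense_diagonal_tree hb hd m0 dH n_bigR.
have [sg [a [r [real_sg r0 marks]]]] := trees _ dense_u.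
have [e eP] := realized_embedding r0 (ltnW L_ge2) real_sg marks.
exact: diagonal_replica r0 eP.
Qed.
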